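(* Let $K\subset\mathbb{D}$ be a compact set and let $\kappa>0$. Then there exists $r_0>0$ so that the following holds. Let $P\in\mathcal{L}_\infty$ be a $\kappa$-good Littlewood series (with respect to $K$) and let $P_n\in\mathcal{L}_n$ be its $n$th prefix. Suppose $\alpha\in K$ is such that $P(\alpha)=0$. Then there exists $\alpha_n\in K$ such that $P_n(\alpha_n)=0$ and $\alpha_n\to\alpha$. If we define $$R_{n,\mathrm{loc}} = R(P_n)\cap \mathbb{D}(\alpha,r_0),$$ then $$\lim_{n\to\infty} d_{\mathrm{H}}\Big(T_{n,\alpha_n}\big(R_{n,\mathrm{loc}}\big),\,\mathcal{D}_\alpha\Big)=0,$$ where $\mathcal{D}_\alpha = P'(\alpha)^{-1}D_\alpha$, with $D_\alpha$ the dragon curve at $\alpha$.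
   Context: $\mathbb{D}=\{z\in\mathbb{C}:|z|<1\}$ and $\mathbb{D}(z,r)=\{w\in\mathbb{C}:|w-z|<r\}$. $\mathcal{L}_n$ (for $n\ge 1$) is the set of polynomials $\sum_{k=0}^n a_k z^k$ with all $a_k\in\{-1,+1\}$ (Littlewood polynomials of degree $n$). $\mathcal{L}_\infty$ is the set of power series $\sum_{k=0}^\infty a_k z^k$ with all $a_k\in\{-1,+1\}$ (Littlewood series), viewed as analytic functions on $\mathbb{D}$. The $n$th prefix of $P=\sum_{k\ge0}a_kz^k\in\mathcal{L}_\infty$ is $P_n=\sum_{k=0}^n a_kz^k$. A Littlewood series $P\in\mathcal{L}_\infty$ is $\kappa$-good with respect to a compact set $K\subset\mathbb{D}$ if $|P'(\alpha)|\ge\kappa$ for every $\alpha\in K$ with $P(\alpha)=0$. For $P_n\in\mathcal{L}_n$ and $f\in\mathcal{L}_\infty$ put $G_{P_n,f}(z)=P_n(z)+z^{n+1}f(z)$, and let $$R(P_n)=\{z\in\mathbb{D}: G_{P_n,f}(z)=0\text{ for some }f\in\mathcal{L}_\infty\}.$$ For $\xi\in\mathbb{D}\setminus\{0\}$, $T_{n,\xi}(z)=\dfrac{z-\xi}{\xi^{n+1}}$, and $T_{n,\xi}(A)$ denotes the image of a set $A$. For $\alpha\in\mathbb{D}$, the dragon curve $D_\alpha\subset\mathbb{C}$ is the unique non-empty compact set with $D_\alpha=\phi_+(D_\alpha)\cup\phi_-(D_\alpha)$, where $\phi_\pm(w)=\pm1+\alpha w$; equivalently $D_\alpha=\{f(\alpha):f\in\mathcal{L}_\infty\}$.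 For $c\in\mathbb{C}$, $cD_\alpha=\{cw:w\in D_\alpha\}$. The Hausdorff distance between non-empty sets $A,B\subset\mathbb{C}$ is $d_{\mathrm{H}}(A,B)=\max\{\sup_{a\in A}\mathrm{dist}(a,B),\ \sup_{b\in B}\mathrm{dist}(b,A)\}$, where $\mathrm{dist}(z,A)=\inf_{a\in A}|z-a|$.
   Formalization: The roots α_n of P_n are claimed in 𝔻 and only for large n, with α_n ∈ K (n large) only if α is interior to K; as stated α_n ∈ K fails, e.g. K={1/2}, P=1−z−z²−…, where P_n(1/2)=2^{-n}≠0. *)

(* Defs.v *)
From Stdlib Require Import Reals List ClassicalEpsilon.
From Coquelicot Require Import Coquelicot.
Open Scope C_scope.

Definition subset_of (A B : C -> Prop) : Prop := forall z, A z -> B z.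

Definition image (f : C -> C) (A : C -> Prop) : C -> Prop :=
  fun w => exists z, A z /\ f z = w.

Definition disk (c : C) (r : R) : C -> Prop := fun z => (Cmod (z - c) < r)%R.

Definition unit_disk : C -> Prop := fun z => (Cmod z < 1)%R.

(* Open covers; the topology of the uniform space [C] is the Euclidean one. *)
Definition is_compact (K : C -> Prop) : Prop :=
  forall F : (C -> Prop) -> Prop,
    (forall U, F U -> open U) ->
    (forall z, K z -> exists U, F U /\ U z) ->
    exists l : list (C -> Prop),
      List.Forall F l /\ forall z, K z -> exists U, In U l /\ U z.

(* A Littlewood series is represented by its coefficient sequence. *)
Definition littlewood (a : nat -> C) : Prop :=
  forall k, a k = 1 \/ a k = - (1).

(* The value of sum_k a_k z^k.  [Series] being total on real sequences, this
   is a total function of z; it is the sum wherever the series converges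
   (see [power_series_correct]). *)
Definition power_series (a : nat -> C) (z : C) : C :=
  (Series (fun k => Re (a k * z ^ k)), Series (fun k => Im (a k * z ^ k))).

Lemma power_series_correct (a : nat -> C) (z l : C) :
  is_pseries (K := C_AbsRing) (V := C_NormedModule) a z l ->
  power_series a z = l.
Proof.
intros H.
assert (E : forall n,
  sum_n (fun k => scal (K := C_AbsRing) (V := C_NormedModule)
                       (pow_n (K := C_AbsRing) z k) (a k)) n =
  (sum_n (fun k => Re (a k * z ^ k)) n, sum_n (fun k => Im (a k * z ^ k)) n)).
{ assert (P : forall k,
    scal (K := C_AbsRing) (V := C_NormedModule)
         (pow_n (K := C_AbsRing) z k) (a k) = a k * z ^ k).
  { intros k.
    assert (Q : pow_n (K := C_AbsRing) z k = z ^ k).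
    { induction k as [|k IH]; [reflexivity|].
      change (z * pow_n (K := C_AbsRing) z k = z * z ^ k); now rewrite IH. }
    rewrite Q; exact (Cmult_comm _ _). }
  induction n as [|n IH].
  - rewrite !sum_O, P; now destruct (a 0%nat * z ^ 0).
  - rewrite !sum_Sn, IH, P; now destruct (a (S n) * z ^ S n). }
assert (B : forall eps : posreal, eventually (fun n =>
  ball (fst l) eps (sum_n (fun k => Re (a k * z ^ k)) n) /\
  ball (snd l) eps (sum_n (fun k => Im (a k * z ^ k)) n))).
{ intros eps.
  destruct (H _ (locally_ball (T := C_NormedModule) l eps)) as [N HN].
  exists N; intros n Hn.
  specialize (HN n Hn); simpl in HN; rewrite E in HN; exact HN. }
destruct l as [x y]; unfold power_series; f_equal;
  apply is_series_unique; apply filterlim_locally; intros eps;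
  refine (filter_imp _ _ _ (B eps)); intros n [Hx Hy]; assumption.
Qed.

(* The n-th prefix has degree n: [sum_n u n] is u 0 + ... + u n. *)
Definition prefix (a : nat -> C) (n : nat) (z : C) : C :=
  sum_n (fun k => a k * z ^ k) n.

(* [C_derive] is total; it is the complex derivative wherever that exists
   ([C_derive_correct]), in particular for Littlewood series on [unit_disk]. *)
Definition good (kappa : R) (K : C -> Prop) (a : nat -> C) : Prop :=
  forall z, K z -> power_series a z = 0 ->
    (kappa <= Cmod (C_derive (power_series a) z))%R.

Definition extension (a : nat -> C) (n : nat) (f : nat -> C) (z : C) : C :=
  prefix a n z + z ^ (n + 1) * power_series f z.

(* R(P_n) for the prefix P_n of the series with coefficients [a]. *)
Definition extension_roots (a : nat -> C) (n : nat) : C -> Prop :=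
  fun z => unit_disk z /\
    exists f, littlewood f /\ extension a n f z = 0.

Definition T (n : nat) (xi z : C) : C := (z - xi) / xi ^ (n + 1).

Definition is_dragon (alpha : C) (D : C -> Prop) : Prop :=
  (exists w, D w) /\ is_compact D /\
  forall w, D w <->
    image (fun v => 1 + alpha * v) D w \/ image (fun v => - (1) + alpha * v) D w.

(* The dragon curve, for |alpha| < 1: the unique set with [is_dragon alpha]. *)
Definition dragon (alpha : C) : C -> Prop :=
  epsilon (inhabits (fun _ : C => False)) (is_dragon alpha).

(* Distances are extended reals: dist(z, A) is +oo when A is empty, and hence
   so is the Hausdorff distance between the empty set and a non-empty one. *)
Definition dist_to (z : C) (A : C -> Prop) : Rbar :=
  Glb_Rbar (fun r => exists a, A a /\ r = Cmod (z - a)).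

Definition excess (A B : C -> Prop) : Rbar :=
  Rbar_lub (fun r => exists a, A a /\ r = dist_to a B).

Definition hausdorff_dist (A B : C -> Prop) : Rbar :=
  if Rbar_le_dec (excess A B) (excess B A) then excess B A else excess A B.

(* Main.v *)
(* A power series [b] with coefficients bounded by 1 satisfies [b(z) = b_0 + z (Sb)(z)], where [S]
   shifts coefficients. A quantity bounded uniformly over such series which grows by at most a
   factor [q < 1] plus a constant [c] when passing from [Sb] to [b] is therefore at most
   [c / (1 - q)]. This gives uniform zeroth, first and second order bounds on [|z| <= q], and so
   a radius [r0], depending only on [K] and [kappa], on which every kappa-good [P] is nearly
   affine around its root [alpha].
   Since [P_n + z^(n+1) f] differs from [P] by O(q^n), Newton's iteration (with fixed slope
   [P'(alpha)]) produces a root in the disk of radius [r0], and every root [z] there lies within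
   O(q^n) of [alpha]. Subtracting [P_n(alpha_n) = 0] from [P_n(z) = - z^(n+1) f(z)] gives
   [(z - alpha_n) / alpha_n^(n+1) ~ - f(alpha) / P'(alpha)] uniformly in [f], and [- f] runs over
   all Littlewood series together with [f]. *)
Require Import Defs.
From Stdlib Require Import Reals Lra Lia List Classical ClassicalEpsilon.
From Coquelicot Require Import Coquelicot.
Open Scope C_scope.

(** * Power series with coefficients bounded by 1 *)

Definition bounded_coef (b : nat -> C) : Prop := forall k, (Cmod (b k) <= 1)%R.

Definition shift (b : nat -> C) : nat -> C := fun k => b (S k).

Lemma shift_bounded (b : nat -> C) : bounded_coef b -> bounded_coef (shift b).
Proof. intros Hb k; apply Hb. Qed.

Lemma littlewood_bounded (a : nat -> C) : littlewood a -> bounded_coef a.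
Proof.
intros Ha k; destruct (Ha k) as [-> | ->]; rewrite ?Cmod_m1, ?Cmod_1; lra.
Qed.

Lemma im_le_Cmod (c : C) : (Rabs (Im c) <= Cmod c)%R.
Proof. eapply Rle_trans; [apply Rmax_r | apply (Rmax_Cmod c)]. Qed.

Lemma Cmod_le_re_im (c : C) : (Cmod c <= Rabs (Re c) + Rabs (Im c))%R.
Proof.
replace c with (RtoC (Re c) + Ci * RtoC (Im c)) at 1.
- eapply Rle_trans; [apply Cmod_triangle|].
  rewrite Cmod_mult, Cmod_Ci, !Cmod_R; lra.
- destruct c as [x y]; unfold RtoC, Ci, Cmult, Cplus; simpl; f_equal; ring.
Qed.

Lemma Cmod_sub_sym (z w : C) : Cmod (z - w) = Cmod (w - z).
Proof. rewrite <- (Cmod_opp (w - z)); f_equal; ring. Qed.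

Lemma Cmod_sub_triangle (x y z : C) :
  (Cmod (x - z) <= Cmod (x - y) + Cmod (y - z))%R.
Proof. replace (x - z) with ((x - y) + (y - z)) by ring; apply Cmod_triangle. Qed.

Lemma Cmod_sub_le (x y : C) : (Cmod (x - y) <= Cmod x + Cmod y)%R.
Proof. rewrite <- (Cmod_opp y); apply Cmod_triangle. Qed.

Lemma Cmod_le_sub (x y : C) : (Cmod x <= Cmod y + Cmod (x - y))%R.
Proof. replace x with (y + (x - y)) at 1 by ring; apply Cmod_triangle. Qed.

(** Comparison with the geometric series in [|z|]. The functional [p] is left abstract so that one
    argument serves both [Re] and [Im]. *)
Lemma ex_series_part (p : C -> R) (b : nat -> C) (z : C) :
  (forall c, (Rabs (p c) <= Cmod c)%R) -> bounded_coef b -> unit_disk z ->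
  ex_series (fun k => Rabs (p (b k * z ^ k))) /\
  (Rabs (Series (fun k => p (b k * z ^ k)%C)) <= / (1 - Cmod z))%R.
Proof.
intros Hp Hb Hz.
assert (Hq : (Rabs (Cmod z) < 1)%R) by (rewrite Rabs_pos_eq; [exact Hz | apply Cmod_ge_0]).
assert (Hle : forall k, (0 <= Rabs (p (b k * z ^ k)%C) <= Cmod z ^ k)%R).
{ intros k; split; [apply Rabs_pos|].
  eapply Rle_trans; [apply Hp|].
  rewrite Cmod_mult, Cmod_pow.
  rewrite <- (Rmult_1_l (Cmod z ^ k)) at 2.
  apply Rmult_le_compat_r; [apply pow_le, Cmod_ge_0 | apply Hb]. }
assert (He : ex_series (fun k => Rabs (p (b k * z ^ k)))).
{ apply (@ex_series_le R_AbsRing R_CompleteNormedModule _ (fun k => (Cmod z ^ k)%R)).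
  - intros k; change norm with Rabs; simpl.
    rewrite Rabs_Rabsolu; apply Hle.
  - now apply ex_series_geom. }
split; [exact He|].
eapply Rle_trans; [now apply Series_Rabs|].
rewrite <- Series_geom by exact Hq.
apply Series_le; [exact Hle | now apply ex_series_geom].
Qed.

(** The factor 2 comes from adding real and imaginary parts. The bound only serves as the a priori
    [M] of [shift_iteration], whose conclusion no longer contains [M]. *)
Lemma power_series_bound_crude (b : nat -> C) (z : C) :
  bounded_coef b -> unit_disk z -> (Cmod (power_series b z) <= 2 / (1 - Cmod z))%R.
Proof.
intros Hb Hz.
eapply Rle_trans; [apply Cmod_le_re_im|].
destruct (ex_series_part Re b z re_le_Cmod Hb Hz) as [_ H1].
destruct (ex_series_part Im b z im_le_Cmod Hb Hz) as [_ H2].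
unfold power_series; simpl in *; lra.
Qed.

Lemma power_series_shift (b : nat -> C) (z : C) :
  bounded_coef b -> unit_disk z ->
  power_series b z = b O + z * power_series (shift b) z.
Proof.
intros Hb Hz.
pose proof (shift_bounded b Hb) as Hs.
assert (E : forall (b : nat -> C) (p : C -> R),
  (forall c, (Rabs (p c) <= Cmod c)%R) -> bounded_coef b ->
  ex_series (fun k => p (b k * z ^ k))).
{ intros c p Hp Hc; apply ex_series_Rabs; now apply ex_series_part. }
unfold power_series.
rewrite (Series_incr_1 (fun k => Re (b k * z ^ k))) by (apply E; auto using re_le_Cmod).
rewrite (Series_incr_1 (fun k => Im (b k * z ^ k))) by (apply E; auto using im_le_Cmod).
rewrite (Series_ext (fun k => Re (b (S k) * z ^ S k))
  (fun k => Re z * Re (shift b k * z ^ k) - Im z * Im (shift b k * z ^ k))%R).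
2:{ intros k; unfold shift; simpl.
    generalize (z ^ k); intros u; destruct (b (S k)), z, u; unfold Re, Im, Cmult; simpl; ring. }
rewrite (Series_ext (fun k => Im (b (S k) * z ^ S k))
  (fun k => Re z * Im (shift b k * z ^ k) + Im z * Re (shift b k * z ^ k))%R).
2:{ intros k; unfold shift; simpl.
    generalize (z ^ k); intros u; destruct (b (S k)), z, u; unfold Re, Im, Cmult; simpl; ring. }
pose proof (E _ _ re_le_Cmod Hs) as ERe.
pose proof (E _ _ im_le_Cmod Hs) as EIm.
rewrite Series_minus, Series_plus, !Series_scal_l
  by (apply (ex_series_scal_l (V := R_NormedModule)); assumption).
generalize (Series (fun k => Re (shift b k * z ^ k))) (Series (fun k => Im (shift b k * z ^ k))).
intros u v; destruct (b O), z; unfold Re, Im, Cmult, Cplus; simpl; f_equal; ring.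
Qed.

Lemma prefix_shift (b : nat -> C) (n : nat) (z : C) :
  prefix b (S n) z = b O + z * prefix (shift b) n z.
Proof.
induction n as [|n IH].
- unfold prefix; rewrite sum_Sn, !sum_O; unfold shift, plus; simpl; ring.
- unfold prefix in *; rewrite sum_Sn, IH, sum_Sn; unfold shift, plus; simpl; ring.
Qed.

Lemma power_series_prefix (b : nat -> C) (n : nat) (z : C) :
  bounded_coef b -> unit_disk z ->
  power_series b z = prefix b n z + z ^ (n + 1) * power_series (fun k => b (n + 1 + k)%nat) z.
Proof.
revert b; induction n as [|n IH]; intros b Hb Hz.
- rewrite power_series_shift by assumption.
  unfold prefix; rewrite sum_O; simpl.
  change (fun k => b (S k)) with (shift b); ring.
- rewrite power_series_shift, IH, prefix_shift by auto using shift_bounded.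
  simpl; unfold shift; simpl; ring.
Qed.

(* Iterating the recursive bound [n] times leaves [c / (1 - q)] plus a multiple of [q ^ n]. *)
Lemma shift_iteration (phi : (nat -> C) -> R) (q M c : R) :
  (0 <= q < 1)%R ->
  (forall b, bounded_coef b -> phi b <= M)%R ->
  (forall b, bounded_coef b -> phi b <= q * phi (shift b) + c)%R ->
  forall b, bounded_coef b -> (phi b <= c / (1 - q))%R.
Proof.
intros HR HM Hc b0 Hb0.
assert (H : forall n b, bounded_coef b ->
  (phi b <= c / (1 - q) + q ^ n * (M - c / (1 - q)))%R).
{ induction n as [|n IH]; intros b Hb.
  - specialize (HM b Hb); simpl; lra.
  - specialize (IH _ (shift_bounded b Hb)); specialize (Hc b Hb).
    eapply Rle_trans; [apply Hc|].
    eapply Rle_trans.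
    + apply Rplus_le_compat_r, Rmult_le_compat_l; [lra | apply IH].
    + right; simpl; field; lra. }
assert (L : is_lim_seq (fun n => c / (1 - q) + q ^ n * (M - c / (1 - q)))%R
              (c / (1 - q) + 0 * (M - c / (1 - q)))%R).
{ apply is_lim_seq_plus'; [apply is_lim_seq_const|].
  apply (is_lim_seq_scal_r _ _ 0), is_lim_seq_geom; rewrite Rabs_pos_eq; lra. }
rewrite Rmult_0_l, Rplus_0_r in L.
exact (is_lim_seq_le _ _ (phi b0) (c / (1 - q))%R (fun n => H n b0 Hb0) (is_lim_seq_const _) L).
Qed.

Lemma power_series_bound (q : R) (b : nat -> C) (z : C) :
  (q < 1)%R -> bounded_coef b -> (Cmod z <= q)%R ->
  (Cmod (power_series b z) <= / (1 - q))%R.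
Proof.
intros HR Hb Hz.
pose proof (Cmod_ge_0 z) as Hz0.
assert (Hd : unit_disk z) by (unfold unit_disk; lra).
replace (/ (1 - q))%R with (1 / (1 - q))%R by (field; lra).
apply (shift_iteration (fun b => Cmod (power_series b z)) q (2 / (1 - Cmod z))); auto.
- lra.
- intros c Hc; now apply power_series_bound_crude.
- intros c Hc; rewrite power_series_shift by assumption.
  eapply Rle_trans; [apply Cmod_triangle|]; rewrite Cmod_mult.
  specialize (Hc O).
  assert (Cmod z * Cmod (power_series (shift c) z) <= q * Cmod (power_series (shift c) z))%R
    by (apply Rmult_le_compat_r; [apply Cmod_ge_0 | exact Hz]).
  lra.
Qed.

Lemma power_series_lipschitz (q : R) (b : nat -> C) (z w : C) :
  (q < 1)%R -> bounded_coef b -> (Cmod z <= q)%R -> (Cmod w <= q)%R ->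
  (Cmod (power_series b z - power_series b w) <= / (1 - q) ^ 2 * Cmod (z - w))%R.
Proof.
intros HR Hb Hz Hw.
pose proof (Cmod_ge_0 z) as Hz0.
assert (Hdz : unit_disk z) by (unfold unit_disk; lra).
assert (Hdw : unit_disk w) by (unfold unit_disk; lra).
replace (/ (1 - q) ^ 2 * Cmod (z - w))%R
  with ((/ (1 - q) * Cmod (z - w)) / (1 - q))%R by (field; lra).
apply (shift_iteration (fun b => Cmod (power_series b z - power_series b w)) q
         (/ (1 - q) + / (1 - q))); auto.
- lra.
- intros c Hc; eapply Rle_trans; [apply Cmod_sub_le|].
  apply Rplus_le_compat; now apply power_series_bound.
- intros c Hc; rewrite !(power_series_shift c) by assumption.
  set (s := power_series (shift c)).
  (* The first summand is the recursive term. The second gives the constant [|z - w| / (1 - q)], by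
     the bound on the shifted series at [w]. *)
  replace (c O + z * s z - (c O + w * s w)) with (z * (s z - s w) + s w * (z - w)) by ring.
  eapply Rle_trans; [apply Cmod_triangle|]; rewrite !Cmod_mult.
  apply Rplus_le_compat; apply Rmult_le_compat_r; auto using Cmod_ge_0.
  apply power_series_bound; auto using shift_bounded.
Qed.

(* From [b(z) = b_0 + z (Sb)(z)] one gets [b'(z) = (Sb)(z) + z (Sb)'(z)], hence
   [b'(z) = sum_k (S^(k+1) b)(z) z^k]; the coefficients are rescaled to be bounded by 1. *)
Definition power_series_deriv (b : nat -> C) (z : C) : C :=
  / RtoC (1 - Cmod z) *
  power_series (fun k => RtoC (1 - Cmod z) * power_series (fun j => b (S (k + j))) z) z.

Lemma power_series_deriv_coef_bounded (b : nat -> C) (z : C) :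
  bounded_coef b -> unit_disk z ->
  bounded_coef (fun k => RtoC (1 - Cmod z) * power_series (fun j => b (S (k + j))) z).
Proof.
unfold unit_disk; intros Hb Hz k.
rewrite Cmod_mult, Cmod_R, Rabs_pos_eq by lra.
assert (H : (Cmod (power_series (fun j => b (S (k + j))) z) <= / (1 - Cmod z))%R).
{ apply power_series_bound; [exact Hz | intros j; apply Hb | apply Rle_refl]. }
apply Rmult_le_compat_l with (r := (1 - Cmod z)%R) in H; [|lra].
rewrite Rinv_r in H by lra; exact H.
Qed.

Lemma power_series_deriv_shift (b : nat -> C) (z : C) :
  bounded_coef b -> unit_disk z ->
  power_series_deriv b z = power_series (shift b) z + z * power_series_deriv (shift b) z.
Proof.
intros Hb Hz; unfold power_series_deriv.
rewrite power_series_shift by (auto using power_series_deriv_coef_bounded).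
unfold shift; simpl.
change (fun j => b (S j)) with (shift b).
assert (RtoC (1 - Cmod z) <> 0) by (intros E; apply RtoC_inj in E; unfold unit_disk in Hz; lra).
field; assumption.
Qed.

Lemma power_series_deriv_bound (q : R) (b : nat -> C) (z : C) :
  (q < 1)%R -> bounded_coef b -> (Cmod z <= q)%R ->
  (Cmod (power_series_deriv b z) <= / (1 - q) ^ 2)%R.
Proof.
intros HR Hb Hz.
pose proof (Cmod_ge_0 z) as Hz0.
assert (Hdz : unit_disk z) by (unfold unit_disk; lra).
replace (/ (1 - q) ^ 2)%R with (/ (1 - q) / (1 - q))%R by (field; lra).
assert (Hcrude : forall c, bounded_coef c ->
  (Cmod (power_series_deriv c z) <= / (1 - Cmod z) * (/ (1 - Cmod z)))%R).
{ intros c Hc; unfold power_series_deriv.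
  assert (RtoC (1 - Cmod z) <> 0) by (intros E; apply RtoC_inj in E; lra).
  rewrite Cmod_mult, Cmod_inv, Cmod_R, Rabs_pos_eq by (auto; lra).
  apply Rmult_le_compat_l; [left; apply Rinv_0_lt_compat; lra|].
  apply power_series_bound; auto using power_series_deriv_coef_bounded; lra. }
apply (shift_iteration (fun b => Cmod (power_series_deriv b z)) q
  (/ (1 - Cmod z) * / (1 - Cmod z))); auto.
- lra.
- intros c Hc; rewrite power_series_deriv_shift by assumption.
  eapply Rle_trans; [apply Cmod_triangle|]; rewrite Cmod_mult, Rplus_comm.
  apply Rplus_le_compat.
  + apply Rmult_le_compat_r; auto using Cmod_ge_0.
  + apply power_series_bound; auto using shift_bounded.
Qed.

(** The slope is taken at [al] for all pairs [z], [w] near [al]. This strict form of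
    differentiability is what Newton's iteration with a fixed slope requires. *)
Lemma power_series_second_order (q delta : R) (b : nat -> C) (al z w : C) :
  (q < 1)%R -> bounded_coef b ->
  (Cmod al <= q)%R -> (Cmod z <= q)%R -> (Cmod w <= q)%R ->
  (Cmod (z - al) <= delta)%R -> (Cmod (w - al) <= delta)%R ->
  (Cmod (power_series b z - power_series b w - power_series_deriv b al * (z - w))
     <= 2 / (1 - q) ^ 3 * delta * Cmod (z - w))%R.
Proof.
intros HR Hb Hal Hz Hw Hdz Hdw.
pose proof (Cmod_ge_0 z) as Hz0.
assert (Haz : unit_disk z) by (unfold unit_disk; lra).
assert (Haw : unit_disk w) by (unfold unit_disk; lra).
assert (Haa : unit_disk al) by (unfold unit_disk; lra).
replace (2 / (1 - q) ^ 3 * delta * Cmod (z - w))%R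
  with ((2 * / (1 - q) ^ 2 * delta * Cmod (z - w)) / (1 - q))%R by (field; lra).
assert (HL : (0 <= / (1 - q) ^ 2)%R) by (left; apply Rinv_0_lt_compat, pow_lt; lra).
apply (shift_iteration
  (fun b => Cmod (power_series b z - power_series b w - power_series_deriv b al * (z - w))) q
  (/ (1 - q) + / (1 - q) + / (1 - q) ^ 2 * Cmod (z - w))); auto.
- lra.
- intros c Hc; eapply Rle_trans; [apply Cmod_sub_le|].
  apply Rplus_le_compat.
  + eapply Rle_trans; [apply Cmod_sub_le|].
    apply Rplus_le_compat; now apply power_series_bound.
  + rewrite Cmod_mult; apply Rmult_le_compat_r; [apply Cmod_ge_0|].
    now apply power_series_deriv_bound.
- intros c Hc.
  rewrite !(power_series_shift c), power_series_deriv_shift by assumption.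
  pose proof (shift_bounded c Hc) as Hs.
  set (s := shift c) in *.
  (* In the factor of [z - w] beside the recursive term, the derivative bound and the Lipschitz
     bound each contribute [delta / (1 - q) ^ 2]. *)
  replace (c O + z * power_series s z - (c O + w * power_series s w) -
      (power_series s al + al * power_series_deriv s al) * (z - w))
    with (z * (power_series s z - power_series s w - power_series_deriv s al * (z - w)) +
      (power_series_deriv s al * (z - al) + (power_series s w - power_series s al)) * (z - w))
    by ring.
  eapply Rle_trans; [apply Cmod_triangle|]; rewrite !(Cmod_mult _ (z - w)), Cmod_mult.
  apply Rplus_le_compat; apply Rmult_le_compat_r; auto using Cmod_ge_0.
  eapply Rle_trans; [apply Cmod_triangle|]; rewrite Cmod_mult.
  pose proof (power_series_deriv_bound q s al HR Hs Hal) as H1.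
  pose proof (power_series_lipschitz q s w al HR Hs Hw Hal) as H2.
  pose proof (Rmult_le_compat _ _ _ _ (Cmod_ge_0 _) (Cmod_ge_0 _) H1 Hdz).
  pose proof (Rmult_le_compat_l _ _ _ HL Hdw).
  lra.
Qed.

(** The balls of the uniform space [C] are squares. A square of half-side [eps / sqrt 2] fits into
    the Euclidean disk of radius [eps]. *)
Lemma locally_Cmod (z : C) (P : C -> Prop) :
  locally z P <-> exists eps : posreal, forall y, (Cmod (y - z) < eps)%R -> P y.
Proof.
split.
- intros [eps H]; exists eps; intros y Hy; apply H.
  now apply C_NormedModule_mixin_compat1.
- intros [eps H].
  assert (H2 : (0 < eps / sqrt 2)%R) by (apply Rdiv_lt_0_compat; [apply eps | apply sqrt_lt_R0; lra]).
  exists (mkposreal _ H2); intros y Hy; apply H.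
  apply C_NormedModule_mixin_compat2 in Hy; simpl in Hy.
  change (minus y z) with (y - z) in Hy.
  eapply Rlt_le_trans; [apply Hy|]; right; field.
  apply Rgt_not_eq, sqrt_lt_R0; lra.
Qed.

(** The second order bound with [w = al] and [delta = |y - al|] has a remainder quadratic in
    [|y - al|]. *)
Lemma C_derive_power_series (b : nat -> C) (al : C) :
  bounded_coef b -> unit_disk al ->
  C_derive (power_series b) al = power_series_deriv b al.
Proof.
unfold unit_disk; intros Hb Hal.
apply is_C_derive_unique.
set (q := ((1 + Cmod al) / 2)%R).
set (D := (2 / (1 - q) ^ 3)%R).
assert (HD : (0 < D)%R).
{ apply Rdiv_lt_0_compat; [lra | apply pow_lt; unfold q; lra]. }
split; [apply is_linear_scal_l|].
intros x Hx eps.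
apply (is_filter_lim_locally_unique (V := AbsRing_NormedModule C_AbsRing)) in Hx; subst x.
(* The first entry keeps [y] in the disk of radius [q], the second makes the remainder at most
   [eps * |y - al|]. *)
assert (He : (0 < Rmin ((1 - Cmod al) / 2) (eps / D))%R).
{ apply Rmin_pos; [lra | apply Rdiv_lt_0_compat; [apply eps | exact HD]]. }
exists (mkposreal _ He); intros y Hy.
change (Cmod (y - al) < Rmin ((1 - Cmod al) / 2) (eps / D))%R in Hy.
change (Cmod (power_series b y - power_series b al - (y - al) * power_series_deriv b al)
  <= eps * Cmod (y - al))%R.
rewrite (Cmult_comm (y - al)).
pose proof (Rmin_l ((1 - Cmod al) / 2) (eps / D)).
pose proof (Rmin_r ((1 - Cmod al) / 2) (eps / D)).
pose proof (Cmod_le_sub y al).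
eapply Rle_trans.
- apply (power_series_second_order q (Cmod (y - al))); auto; unfold q; try lra.
  replace (al - al) with (RtoC 0) by ring; rewrite Cmod_0; apply Cmod_ge_0.
- apply Rmult_le_compat_r; [apply Cmod_ge_0|]; fold q; fold D.
  assert (Cmod (y - al) <= eps / D)%R as H2 by lra.
  apply Rmult_le_compat_l with (r := D) in H2; [|lra].
  replace (D * (eps / D))%R with (pos eps) in H2 by (field; lra); exact H2.
Qed.

Lemma power_series_agree (q : R) (n : nat) (b c : nat -> C) (z : C) :
  (q < 1)%R -> bounded_coef b -> bounded_coef c -> (Cmod z <= q)%R ->
  (forall k, (k <= n)%nat -> b k = c k) ->
  (Cmod (power_series b z - power_series c z) <= q ^ (n + 1) * (2 / (1 - q)))%R.
Proof.
intros HR Hb Hc Hz Hbc.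
assert (Hd : unit_disk z) by (unfold unit_disk; lra).
rewrite (power_series_prefix b n), (power_series_prefix c n) by assumption.
assert (E : prefix b n z = prefix c n z).
{ apply sum_n_ext_loc; intros k Hk; now rewrite Hbc. }
rewrite E.
set (u := power_series _ z); set (v := power_series _ z).
replace (prefix c n z + z ^ (n + 1) * u - (prefix c n z + z ^ (n + 1) * v))
  with (z ^ (n + 1) * (u - v)) by ring.
rewrite Cmod_mult, Cmod_pow.
apply Rmult_le_compat; auto using Cmod_ge_0, pow_le.
- apply pow_incr; split; [apply Cmod_ge_0 | exact Hz].
- eapply Rle_trans; [apply Cmod_sub_le|].
  replace (2 / (1 - q))%R with (/ (1 - q) + / (1 - q))%R by (field; lra).
  apply Rplus_le_compat; apply power_series_bound; auto; intros k; [apply Hb | apply Hc].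
Qed.

Lemma geom_eventually_lt (q A eps : R) :
  (0 <= q < 1)%R -> (0 < eps)%R -> exists n : nat, (q ^ (n + 1) * A < eps)%R.
Proof.
intros HR He.
assert (L : is_lim_seq (fun n => q ^ n * A)%R (0 * A)%R).
{ apply (is_lim_seq_scal_r _ _ 0), is_lim_seq_geom; rewrite Rabs_pos_eq; lra. }
rewrite Rmult_0_l in L.
apply is_lim_seq_spec in L; destruct (L (mkposreal _ He)) as [N HN].
exists N; specialize (HN (N + 1)%nat ltac:(lia)); simpl in HN.
rewrite Rminus_0_r in HN; apply Rabs_lt_between in HN; lra.
Qed.

(** * Compact sets and the dragon curve *)

Lemma open_Cmod_lt (c : C) (r : R) : open (fun z => Cmod (z - c) < r)%R.
Proof.
intros z Hz; apply locally_Cmod.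
exists (mkposreal _ (proj2 (Rlt_0_minus _ _) Hz)); simpl; intros y Hy.
pose proof (Cmod_sub_triangle y z c); lra.
Qed.

Lemma open_Cmod_gt (c : C) (r : R) : open (fun z => r < Cmod (z - c))%R.
Proof.
intros z Hz; apply locally_Cmod.
exists (mkposreal _ (proj2 (Rlt_0_minus _ _) Hz)); simpl; intros y Hy.
pose proof (Cmod_sub_triangle z y c); rewrite (Cmod_sub_sym z y) in H; lra.
Qed.

(** A finite subfamily of an increasing sequence lies inside its member of largest index.
    Boundedness, separation from outside points and containment in a smaller disk all follow from
    suitable increasing sequences. *)
Lemma compact_monotone_cover (K : C -> Prop) (U : nat -> C -> Prop) :
  is_compact K -> (forall n, open (U n)) ->
  (forall n m z, (n <= m)%nat -> U n z -> U m z) ->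
  (forall z, K z -> exists n, U n z) ->
  exists n, forall z, K z -> U n z.
Proof.
intros HK HU Hmono Hcov.
destruct (HK (fun V => exists n, V = U n)) as [l [Hl Hc]].
- intros V [n ->]; apply HU.
- intros z Hz; destruct (Hcov z Hz) as [n Hn]; exists (U n); eauto.
- assert (H : exists n, forall V z, In V l -> V z -> U n z).
  { clear Hc; induction Hl as [|V l [n ->] Hl [m Hm]].
    - exists O; intros V z [].
    - exists (Nat.max n m); intros V z [<- | HV] Hz.
      + apply Hmono with n; [lia | exact Hz].
      + apply Hmono with m; [lia | now apply Hm with V]. }
  destruct H as [n Hn]; exists n; intros z Hz.
  destruct (Hc z Hz) as [V [HV HVz]]; eauto.
Qed.

Lemma compact_bounded (K : C -> Prop) :
  is_compact K -> exists B : R, forall z, K z -> (Cmod z <= B)%R.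
Proof.
intros HK.
destruct (compact_monotone_cover K (fun n z => Cmod (z - 0) < INR n)%R HK) as [n Hn].
- intros n; apply open_Cmod_lt.
- intros n m z Hnm Hz; apply le_INR in Hnm; lra.
- intros z _; destruct (INR_unbounded (Cmod (z - 0))) as [n Hn]; exists n; exact Hn.
- exists (INR n); intros z Hz; specialize (Hn z Hz).
  replace (z - 0) with z in Hn by ring; lra.
Qed.

Lemma inv_INR_antitone (n m : nat) :
  (n <= m)%nat -> (/ (INR m + 1) <= / (INR n + 1))%R.
Proof.
intros H; apply le_INR in H; pose proof (pos_INR n).
apply Rinv_le_contravar; lra.
Qed.

Lemma inv_INR_lt (x : R) : (0 < x)%R -> exists n : nat, (/ (INR n + 1) < x)%R.
Proof.
intros Hx; destruct (INR_unbounded (/ x)) as [n Hn]; exists n.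
rewrite <- (Rinv_inv x); apply Rinv_lt_contravar; [|lra].
apply Rmult_lt_0_compat; pose proof (Rinv_0_lt_compat _ Hx); lra.
Qed.

Lemma compact_separated (K : C -> Prop) (w : C) :
  is_compact K -> ~ K w ->
  exists eps : R, (0 < eps)%R /\ forall z, K z -> (eps < Cmod (z - w))%R.
Proof.
intros HK Hw.
destruct (compact_monotone_cover K (fun n z => / (INR n + 1) < Cmod (z - w))%R HK) as [n Hn].
- intros n; apply open_Cmod_gt.
- intros n m z Hnm Hz; pose proof (inv_INR_antitone _ _ Hnm); lra.
- intros z Hz; apply inv_INR_lt, Cmod_gt_0; intros E; apply Hw.
  replace w with z; [exact Hz|].
  replace z with (z - w + w) by ring; rewrite E; ring.
- exists (/ (INR n + 1))%R; split; [|exact Hn].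
  apply Rinv_0_lt_compat; pose proof (pos_INR n); lra.
Qed.

Lemma compact_in_smaller_disk (K : C -> Prop) :
  is_compact K -> subset_of K unit_disk ->
  exists rho : R, (0 <= rho < 1)%R /\ forall z, K z -> (Cmod z <= rho)%R.
Proof.
intros HK Hd.
destruct (compact_monotone_cover K (fun n z => Cmod (z - 0) < 1 - / (INR n + 1))%R HK)
  as [n Hn].
- intros n; apply open_Cmod_lt.
- intros n m z Hnm Hz; pose proof (inv_INR_antitone _ _ Hnm); lra.
- intros z Hz; specialize (Hd z Hz); unfold unit_disk in Hd.
  destruct (inv_INR_lt (1 - Cmod z)) as [n Hn]; [lra|].
  exists n; replace (z - 0) with z by ring; lra.
- exists (1 - / (INR n + 1))%R; split.
  + pose proof (inv_INR_antitone 0 n ltac:(lia)) as H; simpl in H.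
    rewrite Rplus_0_l, Rinv_1 in H.
    pose proof (pos_INR n); pose proof (Rinv_0_lt_compat (INR n + 1)); lra.
  + intros z Hz; specialize (Hn z Hz).
    replace (z - 0) with z in Hn by ring; lra.
Qed.

(** * The dragon curve as the set of values of Littlewood series *)

Definition littlewood_values (al : C) : C -> Prop :=
  fun w => exists f, littlewood f /\ power_series f al = w.

Definition cylinder (al : C) (f : nat -> C) (n : nat) : C -> Prop :=
  fun w => exists g, littlewood g /\ (forall k, (k < n)%nat -> g k = f k) /\
    power_series g al = w.

Definition finitely_covered (F : (C -> Prop) -> Prop) (A : C -> Prop) : Prop :=
  exists l : list (C -> Prop),
    List.Forall F l /\ forall z, A z -> exists U, In U l /\ U z.

(** A cylinder is the union of two longer ones, according to the sign of coefficient [n]. If both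
    had finite subcovers, concatenating them would cover the whole. *)
Lemma cylinder_refine (al : C) (F : (C -> Prop) -> Prop) (f : nat -> C) (n : nat) :
  littlewood f -> ~ finitely_covered F (cylinder al f n) ->
  exists g, littlewood g /\ (forall k, (k < n)%nat -> g k = f k) /\
    ~ finitely_covered F (cylinder al g (S n)).
Proof.
intros Hf Hn; apply NNPP; intros Hno.
set (upd := fun (e : C) k => if Nat.eq_dec k n then e else f k).
assert (Hc : forall e : C, e = 1 \/ e = - (1) -> finitely_covered F (cylinder al (upd e) (S n))).
{ intros e He; apply NNPP; intros H; apply Hno; exists (upd e); repeat split; auto.
  - intros k; unfold upd; destruct (Nat.eq_dec k n); auto.
  - intros k Hk; unfold upd; destruct (Nat.eq_dec k n); [lia | reflexivity]. }
destruct (Hc 1 (or_introl eq_refl)) as [l1 [Hl1 H1]].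
destruct (Hc (- (1)) (or_intror eq_refl)) as [l2 [Hl2 H2]].
apply Hn; exists (l1 ++ l2)%list; split; [now apply Forall_app|].
intros z (g & Hg & Hgf & Hz).
assert (Hupd : forall e, g n = e -> cylinder al (upd e) (S n) z).
{ intros e He; exists g; repeat split; auto.
  intros k Hk; unfold upd; destruct (Nat.eq_dec k n) as [-> | Hne]; [exact He|].
  apply Hgf; lia. }
destruct (Hg n) as [He | He].
- destruct (H1 z (Hupd _ He)) as [U [HU HUz]]; exists U; rewrite in_app_iff; auto.
- destruct (H2 z (Hupd _ He)) as [U [HU HUz]]; exists U; rewrite in_app_iff; auto.
Qed.

(* König's argument: if no finite subcover exists, refining cylinders coefficient by
   coefficient yields a series whose value has no neighbourhood inside a member of the cover. *)
Lemma littlewood_values_compact (al : C) :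
  unit_disk al -> is_compact (littlewood_values al).
Proof.
intros Hal F HFo HFc; apply NNPP; intros Hnc.
change (~ finitely_covered F (littlewood_values al)) in Hnc.
(* Choice needs a total relation, so the refinement property is conditional. Where the condition
   fails, the series itself is returned. *)
destruct (choice (fun (p : nat * (nat -> C)) g =>
  littlewood (snd p) -> ~ finitely_covered F (cylinder al (snd p) (fst p)) ->
  littlewood g /\ (forall k, (k < fst p)%nat -> g k = snd p k) /\
  ~ finitely_covered F (cylinder al g (S (fst p))))) as [step Hstep].
{ intros [n f]; simpl.
  destruct (classic (littlewood f /\ ~ finitely_covered F (cylinder al f n))) as [[H1 H2] | H].
  - destruct (cylinder_refine al F f n H1 H2) as [g Hg]; exists g; auto.
  - exists f; tauto. }
(* The starting series is arbitrary, because a cylinder of length 0 contains all Littlewood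
   values. *)
set (h := fix h n := match n with O => fun _ => RtoC 1 | S n => step (n, h n) end).
assert (Hh : forall n, littlewood (h n) /\ ~ finitely_covered F (cylinder al (h n) n)).
{ induction n as [|n [IH1 IH2]].
  - split; [intros k; now left|].
    intros [l [Hl H]]; apply Hnc; exists l; split; [exact Hl|].
    intros z [g [Hg Hz]]; apply H; exists g; repeat split; auto; intros k Hk; lia.
  - destruct (Hstep (n, h n) IH1 IH2) as (H1 & _ & H3); split; assumption. }
(* Coefficient [k] is frozen from stage [k + 1] on, which defines the limit series [f] below. *)
assert (Hagree : forall k m, h (S k + m)%nat k = h (S k) k).
{ intros k; induction m as [|m IH]; [now rewrite Nat.add_0_r|].
  rewrite <- IH, Nat.add_succ_r.
  destruct (Hh (S k + m)%nat) as [H1 H2].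
  destruct (Hstep (_, _) H1 H2) as (_ & H & _); apply H; simpl; lia. }
set (f := fun k => h (S k) k).
assert (Hf : littlewood f) by (intros k; apply Hh).
destruct (HFc (power_series f al)) as [U [HU HUf]]; [now exists f|].
destruct (proj1 (locally_Cmod _ _) (HFo U HU _ HUf)) as [eps Heps].
assert (HR : (0 <= Cmod al < 1)%R) by (split; [apply Cmod_ge_0 | exact Hal]).
destruct (geom_eventually_lt (Cmod al) (2 / (1 - Cmod al)) eps HR (cond_pos eps)) as [n Hn].
(* All values in this cylinder are within [eps] of [f(al)], so [U] alone covers it, against the
   construction of [h]. *)
apply (proj2 (Hh (n + 1)%nat)); exists (U :: nil)%list; split; [now repeat constructor|].
intros z (g & Hg & Hgh & <-); exists U; split; [now left|].
apply Heps; eapply Rle_lt_trans; [|exact Hn].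
apply power_series_agree; auto using littlewood_bounded; [apply Rle_refl|].
intros k Hk; rewrite Hgh by lia; unfold f.
replace (n + 1)%nat with (S k + (n - k))%nat by lia; apply Hagree.
Qed.

Lemma littlewood_values_dragon (al : C) :
  unit_disk al -> is_dragon al (littlewood_values al).
Proof.
intros Hal; repeat split.
- exists (power_series (fun _ => RtoC 1) al), (fun _ => RtoC 1); split; [intros k; now left | reflexivity].
- now apply littlewood_values_compact.
- intros [f [Hf <-]].
  rewrite power_series_shift by auto using littlewood_bounded.
  destruct (Hf O) as [-> | ->]; [left | right];
    (exists (power_series (shift f) al); split; [|reflexivity];
     exists (shift f); split; [intros k; apply Hf | reflexivity]).
- assert (Hcons : forall (e : C) (f : nat -> C), e = 1 \/ e = - (1) -> littlewood f ->
    littlewood_values al (e + al * power_series f al)).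
  { intros e f He Hf.
    set (g := fun k => match k with O => e | S k => f k end).
    assert (Hg : littlewood g) by (intros [|k]; simpl; auto).
    exists g; split; [exact Hg|].
    now rewrite power_series_shift by auto using littlewood_bounded. }
  intros [[v [[f [Hf <-]] <-]] | [v [[f [Hf <-]] <-]]]; auto.
Qed.

(** Unrolling the equation [n + 1] times gives points of the form [P_n(al) + al^(n+1) v] with [v] in
    [D], and the last term vanishes in the limit. Compactness enters as boundedness for one
    inclusion and as closedness for the other. *)
Lemma is_dragon_unique (al : C) (D : C -> Prop) :
  unit_disk al -> is_dragon al D -> forall w, D w <-> littlewood_values al w.
Proof.
intros Hal [[w0 Hw0] [HDc HD]].
assert (HR : (0 <= Cmod al < 1)%R) by (split; [apply Cmod_ge_0 | exact Hal]).
intros w; split.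
- intros Hw.
  destruct (compact_bounded D HDc) as [B HB].
  (* Each point of [D] receives a digit and a preimage in [D]. Following preimages from [w] reads
     off the coefficients of a series with value [w]. Points outside [D] receive a dummy pair. *)
  destruct (choice (fun v (p : C * C) => D v ->
    (fst p = 1 \/ fst p = - (1)) /\ D (snd p) /\ v = fst p + al * snd p)) as [dig Hdig].
  { intros v; destruct (classic (D v)) as [Hv | Hv]; [|exists (RtoC 1, RtoC 1); tauto].
    destruct (proj1 (HD v) Hv) as [[u [Hu E]] | [u [Hu E]]];
      [exists (RtoC 1, u) | exists (- (1), u)]; simpl; auto. }
  set (orbit := fix orbit n := match n with O => w | S n => snd (dig (orbit n)) end).
  set (f := fun n => fst (dig (orbit n))).
  assert (Ho : forall n, D (orbit n)).
  { induction n as [|n IH]; [exact Hw | now apply Hdig]. }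
  assert (Hf : littlewood f) by (intros n; now apply Hdig).
  assert (Hexp : forall n, w = prefix f n al + al ^ (n + 1) * orbit (n + 1)%nat).
  { induction n as [|n IH].
    - unfold prefix; rewrite sum_O; simpl.
      rewrite (proj2 (proj2 (Hdig w Hw))) at 1; unfold f; simpl; ring.
    - rewrite IH at 1; unfold prefix; rewrite sum_Sn.
      rewrite (proj2 (proj2 (Hdig _ (Ho (n + 1)%nat)))) at 1.
      replace (S n + 1)%nat with (S (n + 1)) by lia.
      unfold f, plus; replace (S n) with (n + 1)%nat by lia; simpl; ring. }
  exists f; split; [exact Hf|].
  apply NNPP; intros Hne.
  assert (Hpos : (0 < Cmod (power_series f al - w))%R).
  { apply Cmod_gt_0; intros E; apply Hne.
    replace w with (power_series f al - (power_series f al - w)) by ring; rewrite E; ring. }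
  destruct (geom_eventually_lt (Cmod al) (/ (1 - Cmod al) + B) _ HR Hpos) as [n Hn].
  rewrite (Hexp n), (power_series_prefix f n) in Hn by auto using littlewood_bounded.
  set (v := power_series _ al) in Hn.
  replace (prefix f n al + al ^ (n + 1) * v - (prefix f n al + al ^ (n + 1) * orbit (n + 1)%nat))
    with (al ^ (n + 1) * (v - orbit (n + 1)%nat)) in Hn by ring.
  rewrite Cmod_mult, Cmod_pow in Hn.
  apply (Rlt_not_le _ _ Hn), Rmult_le_compat_l; [apply pow_le, HR|].
  eapply Rle_trans; [apply Cmod_sub_le|]; apply Rplus_le_compat; [|now apply HB].
  apply power_series_bound; [apply HR | | apply Rle_refl].
  intros k; now apply littlewood_bounded.
- intros [f [Hf Hw]]; apply NNPP; intros Hn.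
  destruct (compact_separated D w HDc Hn) as [eps [Heps Hsep]].
  (* Composing the maps prescribed by the first [n + 1] coefficients and applying them to [w0]
     yields points of [D] that converge to [f(al)]. *)
  assert (Happ : forall n f, littlewood f -> D (prefix f n al + al ^ (n + 1) * w0)).
  { assert (Hstep : forall f v, littlewood f -> D v -> D (f O + al * v)).
    { intros g v Hg Hv; apply HD.
      destruct (Hg O) as [-> | ->]; [left | right]; now exists v. }
    induction n as [|n IH]; intros g Hg.
    - unfold prefix; rewrite sum_O; simpl.
      replace (g O * 1 + al * 1 * w0) with (g O + al * w0) by ring; now apply Hstep.
    - rewrite prefix_shift; simpl.
      replace (g O + al * prefix (shift g) n al + al * al ^ (n + 1) * w0)
        with (g O + al * (prefix (shift g) n al + al ^ (n + 1) * w0)) by ring.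
      apply Hstep; [exact Hg|]; apply IH; intros k; apply Hg. }
  destruct (geom_eventually_lt (Cmod al) (Cmod w0 + / (1 - Cmod al)) eps HR Heps) as [n Hnn].
  specialize (Hsep _ (Happ n f Hf)).
  rewrite <- Hw, (power_series_prefix f n) in Hsep by auto using littlewood_bounded.
  set (v := power_series _ al) in Hsep.
  replace (prefix f n al + al ^ (n + 1) * w0 - (prefix f n al + al ^ (n + 1) * v))
    with (al ^ (n + 1) * (w0 - v)) in Hsep by ring.
  rewrite Cmod_mult, Cmod_pow in Hsep.
  apply (Rlt_not_le _ _ (Rlt_trans _ _ _ Hnn Hsep)), Rmult_le_compat_l; [apply pow_le, HR|].
  eapply Rle_trans; [apply Cmod_sub_le|]; apply Rplus_le_compat_l.
  apply power_series_bound; [apply HR | | apply Rle_refl].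
  intros k; now apply littlewood_bounded.
Qed.

(** The existence lemma makes [epsilon] return some set with [is_dragon], and uniqueness identifies
    that set. *)
Lemma dragon_values (al w : C) :
  unit_disk al -> dragon al w <-> littlewood_values al w.
Proof.
intros Hal; apply is_dragon_unique; [exact Hal|].
unfold dragon; apply epsilon_spec.
exists (littlewood_values al); now apply littlewood_values_dragon.
Qed.

(** * Hausdorff distance *)

Lemma dist_to_le (z : C) (A : C -> Prop) (eps : R) :
  (exists a, A a /\ (Cmod (z - a) <= eps)%R) ->
  Rbar_le 0 (dist_to z A) /\ Rbar_le (dist_to z A) eps.
Proof.
intros [a [Ha Hza]].
unfold dist_to; destruct (Glb_Rbar_correct (fun r => exists a, A a /\ r = Cmod (z - a)))
  as [Hlb Hglb]; split.
- apply Hglb; intros r [b [_ ->]]; apply Cmod_ge_0.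
- eapply Rbar_le_trans; [apply Hlb; now exists a | exact Hza].
Qed.

(** The lower bound uses a point of [A]: the supremum of the empty set in [Rbar] is minus
    infinity. *)
Lemma excess_le (A B : C -> Prop) (eps : R) :
  (exists a, A a) ->
  (forall a, A a -> exists b, B b /\ (Cmod (a - b) <= eps)%R) ->
  Rbar_le 0 (excess A B) /\ Rbar_le (excess A B) eps.
Proof.
intros [a0 Ha0] H.
unfold excess, Rbar_lub; destruct (Rbar_ex_lub _) as [l [Hub Hlub]]; cbn [proj1_sig]; split.
- apply Rbar_le_trans with (dist_to a0 B).
  + apply (dist_to_le a0 B eps), H, Ha0.
  + apply Hub; now exists a0.
- apply Hlub; intros r [a [Ha ->]]; apply dist_to_le, H, Ha.
Qed.

Lemma hausdorff_dist_le (A B : C -> Prop) (eps : R) :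
  (exists a, A a) -> (exists b, B b) ->
  (forall a, A a -> exists b, B b /\ (Cmod (a - b) <= eps)%R) ->
  (forall b, B b -> exists a, A a /\ (Cmod (b - a) <= eps)%R) ->
  is_finite (hausdorff_dist A B) /\ (0 <= real (hausdorff_dist A B) <= eps)%R.
Proof.
intros HA HB HAB HBA.
assert (H : Rbar_le 0 (hausdorff_dist A B) /\ Rbar_le (hausdorff_dist A B) eps).
{ unfold hausdorff_dist; destruct (Rbar_le_dec _ _); now apply excess_le. }
destruct (hausdorff_dist A B) as [d | |]; simpl in *; [|tauto | tauto].
split; [reflexivity | exact H].
Qed.

(** * Roots of extensions of a prefix *)

Lemma power_series_opp (b : nat -> C) (z : C) :
  power_series (fun k => - b k) z = - power_series b z.
Proof.
unfold power_series, Copp; simpl.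
rewrite <- !Series_opp; f_equal; apply Series_ext; intros k;
  generalize (z ^ k); intros u; destruct (b k), u; unfold Re, Im, Cmult; simpl; ring.
Qed.

Lemma power_series_0 (z : C) : power_series (fun _ => 0) z = 0.
Proof.
unfold power_series, RtoC; f_equal; rewrite (Series_ext _ (fun _ => 0 * 0)%R);
  try (rewrite Series_scal_l; ring); intros k; destruct (z ^ k); simpl; ring.
Qed.

(** The zero sequence is not Littlewood, but its coefficients are bounded by 1. Results on
    extensions by bounded sequences therefore cover the roots of [P_n] itself. *)
Lemma extension_0 (a : nat -> C) (n : nat) (z : C) :
  extension a n (fun _ => 0) z = prefix a n z.
Proof. unfold extension; rewrite power_series_0; ring. Qed.

Lemma pow_lipschitz (q : R) (n : nat) (z w : C) :
  (Cmod z <= q)%R -> (Cmod w <= q)%R ->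
  (Cmod (z ^ (n + 1) - w ^ (n + 1)) <= INR (n + 1) * q ^ n * Cmod (z - w))%R.
Proof.
intros Hz Hw.
pose proof (Cmod_ge_0 z) as Hz0.
induction n as [|n IH].
- simpl; rewrite !Cmult_1_r, !Rmult_1_l; apply Rle_refl.
- replace (S n + 1)%nat with (S (n + 1)) by lia.
  simpl Cpow.
  replace (z * z ^ (n + 1) - w * w ^ (n + 1))
    with (z * (z ^ (n + 1) - w ^ (n + 1)) + w ^ (n + 1) * (z - w)) by ring.
  eapply Rle_trans; [apply Cmod_triangle|]; rewrite !Cmod_mult, Cmod_pow.
  assert (H1 : (Cmod w ^ (n + 1) <= q ^ (n + 1))%R)
    by (apply pow_incr; split; [apply Cmod_ge_0 | exact Hw]).
  apply Rmult_le_compat_r with (r := Cmod (z - w)) in H1; [|apply Cmod_ge_0].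
  pose proof (Rmult_le_compat _ _ _ _ Hz0 (Cmod_ge_0 _) Hz IH) as H2.
  rewrite S_INR; rewrite (pow_add q n 1), pow_1 in H1; simpl pow; lra.
Qed.

Lemma exp_le (x y : R) : (x <= y)%R -> (exp x <= exp y)%R.
Proof. intros [H | ->]; [left; now apply exp_increasing | apply Rle_refl]. Qed.

(** Induction through [1 + t <= exp t]. For [m = n + 1] and [|v - 1| = O(q^n)] the exponent is
    [O(n q^n)], so the power tends to 1. *)
Lemma pow_near_1 (v : C) (m : nat) :
  (Cmod (v ^ m - 1) <= exp (INR m * Cmod (v - 1)) - 1)%R.
Proof.
induction m as [|m IH].
- simpl; replace (RtoC 1 - 1) with (RtoC 0) by ring.
  rewrite Cmod_0, Rmult_0_l, exp_0; lra.
- rewrite S_INR; simpl Cpow.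
  replace (v * v ^ m - 1) with (v * (v ^ m - 1) + (v - 1)) by ring.
  eapply Rle_trans; [apply Cmod_triangle|]; rewrite Cmod_mult.
  set (t := Cmod (v - 1)) in *.
  assert (Ht : (Cmod v <= 1 + t)%R).
  { pose proof (Cmod_le_sub v 1) as H; rewrite Cmod_1 in H; exact H. }
  replace ((INR m + 1) * t)%R with (t + INR m * t)%R by ring; rewrite exp_plus.
  pose proof (exp_ineq1_le t).
  pose proof (exp_pos (INR m * t)).
  pose proof (Rmult_le_compat _ _ _ _ (Cmod_ge_0 v) (Cmod_ge_0 _) Ht IH).
  assert ((1 + t) * exp (INR m * t) <= exp t * exp (INR m * t))%R
    by (apply Rmult_le_compat_r; lra).
  lra.
Qed.

Lemma Cmod_eq_0_of_le_geom (z : C) (A : R) :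
  (forall n : nat, (Cmod z <= (/ 2) ^ (n + 1) * A)%R) -> z = 0.
Proof.
intros H; apply NNPP; intros Hne; apply Cmod_gt_0 in Hne.
destruct (geom_eventually_lt (/ 2) A (Cmod z)) as [n Hn]; [lra | exact Hne|].
specialize (H n); lra.
Qed.

(** The map [z - F z / d] contracts distances by 1/2 and moves the centre by at most [r / 2], so it
    preserves the closed disk. Its fixed point there is the root. *)
Lemma newton_root (F : C -> C) (c d : C) (r : R) :
  d <> 0 ->
  (forall z w, (Cmod (z - c) <= r)%R -> (Cmod (w - c) <= r)%R ->
    (Cmod (F z - F w - d * (z - w)) <= Cmod d / 2 * Cmod (z - w))%R) ->
  (Cmod (F c) <= Cmod d * (r / 2))%R ->
  exists z, (Cmod (z - c) <= r)%R /\ F z = 0.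
Proof.
intros Hd HF Hc.
assert (Hd0 : (0 < Cmod d)%R) by now apply Cmod_gt_0.
set (N := fun z => z - F z / d).
assert (HN : forall z w, (Cmod (z - c) <= r)%R -> (Cmod (w - c) <= r)%R ->
  (Cmod (N z - N w) <= / 2 * Cmod (z - w))%R).
{ intros z w Hz Hw; unfold N.
  replace (z - F z / d - (w - F w / d)) with (- ((F z - F w - d * (z - w)) / d))
    by (field; exact Hd).
  rewrite Cmod_opp, Cmod_div by exact Hd.
  apply Rle_div_l; [exact Hd0|].
  eapply Rle_trans; [now apply HF|]; right; field. }
assert (Hr : (0 <= r)%R).
{ pose proof (Cmod_ge_0 (F c)).
  apply Rmult_le_reg_l with (Cmod d); lra. }
assert (Hcc : (Cmod (c - c) <= r)%R)
  by (replace (c - c) with (RtoC 0) by ring; rewrite Cmod_0; exact Hr).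
assert (HNc : (Cmod (N c - c) <= r / 2)%R).
{ unfold N; replace (c - F c / d - c) with (- (F c / d)) by ring.
  rewrite Cmod_opp, Cmod_div by exact Hd.
  apply Rle_div_l; [exact Hd0 | lra]. }
assert (Hdisk : forall z, (Cmod (z - c) <= r)%R -> (Cmod (N z - c) <= r)%R).
{ intros z Hz; pose proof (HN z c Hz Hcc); pose proof (Cmod_sub_triangle (N z) (N c) c); lra. }
set (x := fun k => Nat.iter k N c).
assert (Hx : forall k, (Cmod (x k - c) <= r)%R).
{ induction k; [exact Hcc | now apply Hdisk]. }
(* Applying the map [m] times to the pair [x j], [c], at distance at most [r], halves the distance
   [m] times. *)
assert (Hxx : forall m j, (Cmod (x (m + j)%nat - x m) <= (/ 2) ^ m * r)%R).
{ intros m j; induction m as [|m IH].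
  - rewrite pow_O, Rmult_1_l; apply Hx.
  - simpl Nat.add; change (x (S (m + j))) with (N (x (m + j)%nat)).
    change (x (S m)) with (N (x m)).
    eapply Rle_trans; [now apply HN|]; simpl pow; lra. }
destruct (proj1 (filterlim_locally_cauchy (U := C_R_CompleteNormedModule) (F := eventually) x))
  as [l Hl].
{ intros eps.
  destruct (geom_eventually_lt (/ 2) (2 * r) eps) as [n Hn]; [lra | apply eps|].
  exists (fun k => (n + 1 <= k)%nat); split; [now exists (n + 1)%nat|].
  intros u v Hu Hv.
  apply (C_NormedModule_mixin_compat1 (x u) (x v) eps).
  change (Cmod (x v - x u) < eps)%R.
  pose proof (Hxx (n + 1)%nat (u - (n + 1))%nat) as H1.
  pose proof (Hxx (n + 1)%nat (v - (n + 1))%nat) as H2.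
  replace (n + 1 + (u - (n + 1)))%nat with u in H1 by lia.
  replace (n + 1 + (v - (n + 1)))%nat with v in H2 by lia.
  pose proof (Cmod_sub_triangle (x v) (x (n + 1)%nat) (x u)) as H3.
  rewrite (Cmod_sub_sym (x (n + 1)%nat) (x u)) in H3; lra. }
assert (Hlim : forall m, (Cmod (l - x m) <= (/ 2) ^ m * r)%R).
{ intros m; apply le_epsilon; intros e He.
  destruct (Hl (fun y => Cmod (y - l) < e)%R) as [N0 HN0].
  { apply (proj2 (locally_Cmod l _)); exists (mkposreal e He); auto. }
  specialize (HN0 (m + N0)%nat ltac:(lia)).
  pose proof (Hxx m N0); pose proof (Cmod_sub_triangle l (x (m + N0)%nat) (x m)) as H1.
  rewrite (Cmod_sub_sym l (x (m + N0)%nat)) in H1; lra. }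
assert (Hlc : (Cmod (l - c) <= r)%R).
{ specialize (Hlim O); rewrite pow_O, Rmult_1_l in Hlim; exact Hlim. }
exists l; split; [exact Hlc|].
(* Both [N l] and [l] are within [(/ 2) ^ (n + 1) * r] of the iterate [x (S n)]. *)
assert (E : N l - l = 0).
{ apply (Cmod_eq_0_of_le_geom _ (2 * r)); intros n.
  pose proof (HN l (x n) Hlc (Hx n)) as H1.
  pose proof (Hlim n); pose proof (Hlim (S n)) as H2.
  change (x (S n)) with (N (x n)) in H2; rewrite Cmod_sub_sym in H2.
  pose proof (Cmod_sub_triangle (N l) (N (x n)) l).
  rewrite Nat.add_1_r; simpl pow in *; lra. }
unfold N in E.
replace (F l) with (- (l - F l / d - l) * d) by (field; exact Hd).
rewrite E; ring.
Qed.

(** * Extensions as small perturbations of the series *)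

(** A Lipschitz constant on [|z| <= q] of [z^(n+1) (f(z) - t(z))], with [t] the tail of the series:
    one term from varying the power, one from varying the bracket. *)
Definition perturbation_lip (q : R) (n : nat) : R :=
  (INR (n + 1) * q ^ n * (2 / (1 - q)) + q ^ (n + 1) * (2 / (1 - q) ^ 2))%R.

Lemma extension_sub (a f : nat -> C) (n : nat) (z : C) :
  bounded_coef a -> unit_disk z ->
  extension a n f z - power_series a z =
  z ^ (n + 1) * (power_series f z - power_series (fun k => a (n + 1 + k)%nat) z).
Proof.
intros Ha Hz; rewrite (power_series_prefix a n) by assumption; unfold extension; ring.
Qed.

Lemma extension_close (q : R) (a f : nat -> C) (n : nat) (z : C) :
  (q < 1)%R -> bounded_coef a -> bounded_coef f -> (Cmod z <= q)%R ->
  (Cmod (extension a n f z - power_series a z) <= q ^ (n + 1) * (2 / (1 - q)))%R.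
Proof.
intros HR Ha Hf Hz.
rewrite extension_sub by (auto; unfold unit_disk; lra).
rewrite Cmod_mult, Cmod_pow.
apply Rmult_le_compat; auto using Cmod_ge_0, pow_le.
- apply pow_incr; split; [apply Cmod_ge_0 | exact Hz].
- eapply Rle_trans; [apply Cmod_sub_le|].
  replace (2 / (1 - q))%R with (/ (1 - q) + / (1 - q))%R by (field; lra).
  apply Rplus_le_compat; apply power_series_bound; auto; intros k; apply Ha.
Qed.

Lemma extension_sub_lipschitz (q : R) (a f : nat -> C) (n : nat) (z w : C) :
  (q < 1)%R -> bounded_coef a -> bounded_coef f -> (Cmod z <= q)%R -> (Cmod w <= q)%R ->
  (Cmod ((extension a n f z - power_series a z) - (extension a n f w - power_series a w))
     <= perturbation_lip q n * Cmod (z - w))%R.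
Proof.
intros HR Ha Hf Hz Hw.
rewrite !extension_sub by (auto; unfold unit_disk; lra).
set (t := fun k => a (n + 1 + k)%nat).
assert (Ht : bounded_coef t) by (intros k; apply Ha).
replace (z ^ (n + 1) * (power_series f z - power_series t z) -
    w ^ (n + 1) * (power_series f w - power_series t w))
  with ((z ^ (n + 1) - w ^ (n + 1)) * (power_series f z - power_series t z) +
    w ^ (n + 1) * ((power_series f z - power_series f w) -
      (power_series t z - power_series t w))) by ring.
eapply Rle_trans; [apply Cmod_triangle|]; rewrite !Cmod_mult, Cmod_pow.
unfold perturbation_lip; rewrite Rmult_plus_distr_r; apply Rplus_le_compat.
- rewrite Rmult_assoc, (Rmult_comm (2 / (1 - q))), <- Rmult_assoc.
  apply Rmult_le_compat; auto using Cmod_ge_0, pow_lipschitz.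
  eapply Rle_trans; [apply Cmod_sub_le|].
  replace (2 / (1 - q))%R with (/ (1 - q) + / (1 - q))%R by (field; lra).
  apply Rplus_le_compat; now apply power_series_bound.
- rewrite Rmult_assoc.
  apply Rmult_le_compat; auto using Cmod_ge_0, pow_le.
  + apply pow_incr; split; [apply Cmod_ge_0 | exact Hw].
  + eapply Rle_trans; [apply Cmod_sub_le|].
    replace (2 / (1 - q) ^ 2 * Cmod (z - w))%R
      with (/ (1 - q) ^ 2 * Cmod (z - w) + / (1 - q) ^ 2 * Cmod (z - w))%R by (field; lra).
    apply Rplus_le_compat; now apply power_series_lipschitz.
Qed.

Lemma extension_first_order (q delta : R) (a f : nat -> C) (n : nat) (al z w : C) :
  (q < 1)%R -> bounded_coef a -> bounded_coef f ->
  (Cmod al <= q)%R -> (Cmod z <= q)%R -> (Cmod w <= q)%R ->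
  (Cmod (z - al) <= delta)%R -> (Cmod (w - al) <= delta)%R ->
  (Cmod (extension a n f z - extension a n f w - power_series_deriv a al * (z - w))
     <= (2 / (1 - q) ^ 3 * delta + perturbation_lip q n) * Cmod (z - w))%R.
Proof.
intros HR Ha Hf Hal Hz Hw Hdz Hdw.
pose proof (power_series_second_order q delta a al z w HR Ha Hal Hz Hw Hdz Hdw) as H1.
pose proof (extension_sub_lipschitz q a f n z w HR Ha Hf Hz Hw) as H2.
set (P := power_series a) in *; set (G := extension a n f) in *.
replace (G z - G w - power_series_deriv a al * (z - w))
  with ((P z - P w - power_series_deriv a al * (z - w)) + ((G z - P z) - (G w - P w))) by ring.
eapply Rle_trans; [apply Cmod_triangle|]; lra.
Qed.

(** The solution [x] of [(kappa / 2) x = 2 q^n / (1 - q)], whose right side dominates the distance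
    between the extension and the series. *)
Definition root_radius (q kappa : R) (n : nat) : R := (4 / (kappa * (1 - q)) * q ^ n)%R.

(** At a root of the extension [P] is small, while [P(z)] is close to [P'(al) (z - al)]. The
    remainder consumes at most [kappa / 4] of the slope, so a slope of [kappa / 2] survives. *)
Lemma extension_root_close (q kappa r : R) (a f : nat -> C) (n : nat) (al z : C) :
  (0 <= q < 1)%R -> (0 < kappa)%R -> bounded_coef a -> bounded_coef f ->
  (Cmod al + r <= q)%R -> (2 / (1 - q) ^ 3 * r <= kappa / 4)%R ->
  (kappa <= Cmod (power_series_deriv a al))%R -> power_series a al = 0 ->
  (Cmod (z - al) <= r)%R -> extension a n f z = 0 ->
  (Cmod (z - al) <= root_radius q kappa n)%R.
Proof.
intros HR Hk Ha Hf Hal Hr Hd Hroot Hz Hfz.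
assert (Hr0 : (0 <= r)%R) by (pose proof (Cmod_ge_0 (z - al)); lra).
assert (HzR : (Cmod z <= q)%R) by (pose proof (Cmod_le_sub z al); lra).
assert (H0 : (Cmod (al - al) <= r)%R).
{ replace (al - al) with (RtoC 0) by ring; rewrite Cmod_0; exact Hr0. }
pose proof (extension_close q a f n z (proj2 HR) Ha Hf HzR) as H1.
rewrite Hfz in H1.
pose proof (power_series_second_order q r a al z al (proj2 HR) Ha ltac:(lra) HzR ltac:(lra) Hz H0)
  as H2.
rewrite Hroot in H2.
set (d := power_series_deriv a al) in *; set (p := power_series a z) in *.
assert (H3 : (Cmod (d * (z - al)) <= Cmod (0 - p) + Cmod (p - 0 - d * (z - al)))%R).
{ rewrite <- (Cmod_opp (p - 0 - d * (z - al))), Cmod_sub_sym.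
  replace (d * (z - al)) with ((p - 0) + - (p - 0 - d * (z - al))) at 1 by ring.
  apply Cmod_triangle. }
rewrite Cmod_mult in H3.
pose proof (Cmod_ge_0 (z - al)) as Hx; set (x := Cmod (z - al)) in *.
pose proof (Rmult_le_compat_r x _ _ Hx Hd).
pose proof (Rmult_le_compat_r x _ _ Hx Hr).
assert (H6 : (q ^ (n + 1) <= q ^ n)%R).
{ rewrite pow_add, pow_1; pose proof (pow_le q n (proj1 HR)).
  rewrite <- (Rmult_1_r (q ^ n)) at 2; apply Rmult_le_compat_l; lra. }
assert (H7 : (0 < 2 / (1 - q))%R) by (apply Rdiv_lt_0_compat; lra).
apply Rmult_le_compat_r with (r := (2 / (1 - q))%R) in H6; [|lra].
apply Rmult_le_reg_l with (kappa / 2)%R; [lra|].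
unfold root_radius.
replace (kappa / 2 * (4 / (kappa * (1 - q)) * q ^ n))%R with (q ^ n * (2 / (1 - q)))%R
  by (field; lra).
pose proof (Rmult_le_pos _ _ (Rlt_le _ _ Hk) Hx).
lra.
Qed.

Lemma extension_root_exists (q kappa r : R) (a f : nat -> C) (n : nat) (al : C) :
  (0 <= q < 1)%R -> (0 < kappa)%R -> bounded_coef a -> bounded_coef f ->
  (0 < r)%R -> (Cmod al + r <= q)%R -> (2 / (1 - q) ^ 3 * r <= kappa / 4)%R ->
  (kappa <= Cmod (power_series_deriv a al))%R -> power_series a al = 0 ->
  (perturbation_lip q n <= kappa / 4)%R -> (root_radius q kappa n <= r / 2)%R ->
  exists z, (Cmod (z - al) < r)%R /\ extension a n f z = 0.
Proof.
intros HR Hk Ha Hf Hr0 Hal Hr Hd Hroot Hlip Hrad.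
assert (Hdisk : forall z, (Cmod (z - al) <= r / 2)%R -> (Cmod z <= q)%R).
{ intros z Hz; pose proof (Cmod_le_sub z al); lra. }
assert (HD : (0 < 2 / (1 - q) ^ 3)%R) by (apply Rdiv_lt_0_compat; [lra | apply pow_lt; lra]).
(* Half the radius is used so that the root falls strictly inside the open disk of radius [r]. The
   slope deviation is then at most [kappa / 8 + kappa / 4]. *)
destruct (newton_root (extension a n f) al (power_series_deriv a al) (r / 2)) as [z [Hz Hfz]].
- apply Cmod_gt_0; lra.
- intros z w Hz Hw.
  eapply Rle_trans.
  + apply (extension_first_order q (r / 2)); auto; lra.
  + apply Rmult_le_compat_r; [apply Cmod_ge_0|]; lra.
- pose proof (extension_close q a f n al (proj2 HR) Ha Hf ltac:(lra)) as H.
  rewrite Hroot in H.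
  replace (extension a n f al - 0) with (extension a n f al) in H by ring.
  assert (H6 : (q ^ (n + 1) <= q ^ n)%R).
  { rewrite pow_add, pow_1; pose proof (pow_le q n (proj1 HR)).
    rewrite <- (Rmult_1_r (q ^ n)) at 2; apply Rmult_le_compat_l; lra. }
  assert (H7 : (0 < 2 / (1 - q))%R) by (apply Rdiv_lt_0_compat; lra).
  apply Rmult_le_compat_r with (r := (2 / (1 - q))%R) in H6; [|lra].
  assert (H8 : (q ^ n * (2 / (1 - q)) = kappa * (root_radius q kappa n / 2))%R)
    by (unfold root_radius; field; lra).
  assert (kappa * (root_radius q kappa n / 2) <= kappa * (r / 2 / 2))%R
    by (apply Rmult_le_compat_l; lra).
  assert (kappa * (r / 2 / 2) <= Cmod (power_series_deriv a al) * (r / 2 / 2))%R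
    by (apply Rmult_le_compat_r; lra).
  lra.
- exists z; split; [lra | exact Hfz].
Qed.

(** * Rescaling *)

(** The constant of [extension_first_order] when both points lie within [root_radius] of the
    root. *)
Definition slope_error (q kappa : R) (n : nat) : R :=
  (2 / (1 - q) ^ 3 * root_radius q kappa n + perturbation_lip q n)%R.

(** Bounds [|(z / xi)^(n+1) - 1|] by [pow_near_1]. Here [|z - xi|] is at most twice [root_radius]
    and [|xi|] is at least [x / 2], whence the 4. *)
Definition ratio_error (q kappa x : R) (n : nat) : R :=
  (exp (INR (n + 1) * (4 * root_radius q kappa n / x)) - 1)%R.

(** The first line is the linearisation error of [P_n] after rescaling. The second is the cost of
    replacing [z^(n+1) f(z)] by [xi^(n+1) f(al)]. Neither involves [f]. *)
Definition rescaling_error (q kappa x : R) (n : nat) : R :=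
  (slope_error q kappa n * (2 / (1 - q) / kappa ^ 2) * (1 + ratio_error q kappa x n) +
   (ratio_error q kappa x n * / (1 - q) + / (1 - q) ^ 2 * root_radius q kappa n) / kappa)%R.

(* A root [z] of [P_n + z^(n+1) f] satisfies [P_n(z) - P_n(xi) = - z^(n+1) f(z)] when
   [P_n(xi) = 0]; the left side is about [P'(al) (z - xi)] and [(z / xi)^(n+1)] is about 1. *)
Lemma rescaled_root_close (q kappa : R) (a f : nat -> C) (n : nat) (al xi z : C) :
  (0 <= q < 1)%R -> (0 < kappa)%R -> bounded_coef a -> bounded_coef f ->
  al <> 0 -> (Cmod al <= q)%R -> (Cmod xi <= q)%R -> (Cmod z <= q)%R ->
  (kappa <= Cmod (power_series_deriv a al))%R ->
  prefix a n xi = 0 -> extension a n f z = 0 ->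
  (Cmod (xi - al) <= root_radius q kappa n)%R ->
  (Cmod (z - al) <= root_radius q kappa n)%R ->
  (slope_error q kappa n <= kappa / 2)%R -> (root_radius q kappa n <= Cmod al / 2)%R ->
  (Cmod (T n xi z - / power_series_deriv a al * - power_series f al)
     <= rescaling_error q kappa (Cmod al) n)%R.
Proof.
intros HR Hk Ha Hf Hal0 Hal HxiR HzR Hd Hxi Hz Hxis Hzs Heta Hs.
set (d := power_series_deriv a al) in *.
set (s := root_radius q kappa n) in *; set (eta := slope_error q kappa n) in *.
apply Cmod_gt_0 in Hal0.
assert (Hd0 : d <> 0) by (apply Cmod_gt_0; lra).
assert (Hxi_lb : (Cmod al / 2 <= Cmod xi)%R).
{ pose proof (Cmod_le_sub al xi) as H; rewrite Cmod_sub_sym in H; lra. }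
assert (Hxi0 : xi <> 0) by (apply Cmod_gt_0; lra).
assert (Hpow0 : xi ^ (n + 1) <> 0) by now apply Cpow_nz.
assert (Hs0 : (0 <= s)%R) by (pose proof (Cmod_ge_0 (z - al)); lra).
set (M := (/ (1 - q))%R).
assert (HM : (0 < M)%R) by (apply Rinv_0_lt_compat; lra).
set (fz := power_series f z).
assert (Hfz : (Cmod fz <= M)%R) by (apply power_series_bound; auto; lra).
assert (Hfd : (Cmod (fz - power_series f al) <= / (1 - q) ^ 2 * s)%R).
{ eapply Rle_trans; [apply (power_series_lipschitz q); auto; lra|].
  apply Rmult_le_compat_l; [left; apply Rinv_0_lt_compat, pow_lt; lra | exact Hzs]. }
(* First order expansion of [P_n], seen as the extension by the zero series, with [P_n(xi) = 0] and
   [P_n(z) = - z^(n+1) f(z)]. *)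
assert (Hlin : (Cmod (d * (z - xi) + z ^ (n + 1) * fz) <= eta * Cmod (z - xi))%R).
{ pose proof (extension_first_order q s a (fun _ => RtoC 0) n al z xi (proj2 HR) Ha
    ltac:(intros k; rewrite Cmod_0; lra) Hal HzR HxiR Hzs Hxis) as H.
  rewrite !extension_0, Hxi in H.
  fold d in H; change (2 / (1 - q) ^ 3 * s + perturbation_lip q n)%R with eta in H.
  eapply Rle_trans; [|exact H]; right.
  unfold extension in Hz; fold fz in Hz.
  rewrite <- Cmod_opp; f_equal.
  replace (z ^ (n + 1) * fz) with (prefix a n z + z ^ (n + 1) * fz - prefix a n z) by ring.
  rewrite Hz; ring. }
set (v := (z / xi) ^ (n + 1)).
assert (Hv : z ^ (n + 1) = v * xi ^ (n + 1)).
{ unfold v; rewrite <- Cpow_mult_l; f_equal; field; exact Hxi0. }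
(* Since [eta <= kappa / 2], half of the slope can be absorbed on the left, so [z - xi] has the
   order of [z^(n+1)]. *)
assert (Hdist : (Cmod (z - xi) <= 2 / kappa * M * Cmod v * Cmod (xi ^ (n + 1)))%R).
{ pose proof (Cmod_ge_0 (z - xi)) as Hx.
  assert (H1 : (Cmod (d * (z - xi)) <= Cmod (z ^ (n + 1) * fz) + eta * Cmod (z - xi))%R).
  { replace (d * (z - xi))
      with (- (z ^ (n + 1) * fz) + (d * (z - xi) + z ^ (n + 1) * fz)) by ring.
    eapply Rle_trans; [apply Cmod_triangle|]; rewrite Cmod_opp; lra. }
  rewrite Hv, !Cmod_mult in H1.
  pose proof (Rmult_le_compat_r _ _ _ Hx Hd) as H2.
  pose proof (Rmult_le_compat_r _ _ _ Hx Heta) as H3.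
  assert (H4 : (Cmod v * Cmod (xi ^ (n + 1)) * Cmod fz <= Cmod v * Cmod (xi ^ (n + 1)) * M)%R).
  { apply Rmult_le_compat_l; [apply Rmult_le_pos; apply Cmod_ge_0 | exact Hfz]. }
  apply Rmult_le_reg_l with (kappa / 2)%R; [lra|].
  replace (kappa / 2 * (2 / kappa * M * Cmod v * Cmod (xi ^ (n + 1))))%R
    with (Cmod v * Cmod (xi ^ (n + 1)) * M)%R by (field; lra).
  lra. }
set (theta := ratio_error q kappa (Cmod al) n).
assert (Hv1 : (Cmod (v - 1) <= theta)%R).
{ unfold theta, ratio_error; fold s.
  eapply Rle_trans; [apply pow_near_1|].
  apply Rplus_le_compat_r, exp_le, Rmult_le_compat_l; [apply pos_INR|].
  replace (z / xi - 1) with ((z - xi) / xi) by (field; exact Hxi0).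
  rewrite Cmod_div by exact Hxi0.
  apply Rle_div_l; [lra|].
  replace (4 * s / Cmod al * Cmod xi)%R with (2 * s * (2 * Cmod xi / Cmod al))%R by (field; lra).
  assert (H1 : (1 <= 2 * Cmod xi / Cmod al)%R) by (apply Rle_div_r; lra).
  apply Rmult_le_compat_l with (r := (2 * s)%R) in H1; [|lra].
  pose proof (Cmod_sub_triangle z al xi) as H2; rewrite (Cmod_sub_sym al) in H2; lra. }
assert (Hvb : (Cmod v <= 1 + theta)%R).
{ pose proof (Cmod_le_sub v 1) as H; rewrite Cmod_1 in H; lra. }
assert (Heta0 : (0 <= eta)%R).
{ apply Rplus_le_le_0_compat.
  - apply Rmult_le_pos; [|exact Hs0].
    left; apply Rdiv_lt_0_compat; [lra | apply pow_lt; lra].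
  - unfold perturbation_lip; apply Rplus_le_le_0_compat;
      repeat apply Rmult_le_pos; try apply pos_INR; try (apply pow_le; lra); try lra;
      left; apply Rinv_0_lt_compat; [lra | apply pow_lt; lra]. }
assert (Hd1 : (0 < Cmod d)%R) by lra.
assert (Hxin : (0 < Cmod (xi ^ (n + 1)))%R) by now apply Cmod_gt_0.
(* An exact splitting into the linearisation error and the error on the right side, matching the two
   lines of [rescaling_error]. *)
replace (T n xi z - / d * - power_series f al)
  with ((d * (z - xi) + z ^ (n + 1) * fz) / (d * xi ^ (n + 1)) -
        ((v - 1) * fz + (fz - power_series f al)) / d).
2:{ unfold T; rewrite Hv; field; auto. }
eapply Rle_trans; [apply Cmod_sub_le|].
unfold rescaling_error; fold eta theta s; apply Rplus_le_compat.
- rewrite Cmod_div by (now apply Cmult_neq_0); rewrite Cmod_mult.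
  apply Rle_div_l; [now apply Rmult_lt_0_compat|].
  eapply Rle_trans; [exact Hlin|].
  rewrite !Rmult_assoc; apply Rmult_le_compat_l; [exact Heta0|].
  eapply Rle_trans; [exact Hdist|].
  apply Rle_trans with (2 / kappa * M * (1 + theta) * Cmod (xi ^ (n + 1)))%R.
  { apply Rmult_le_compat_r; [lra|]; apply Rmult_le_compat_l; [|exact Hvb].
    apply Rmult_le_pos; [left; apply Rdiv_lt_0_compat|]; lra. }
  replace (2 / (1 - q) / kappa ^ 2 * ((1 + theta) * (Cmod d * Cmod (xi ^ (n + 1)))))%R
    with (2 / kappa * M * (1 + theta) * Cmod (xi ^ (n + 1)) * (Cmod d / kappa))%R
    by (unfold M; field; lra).
  rewrite <- (Rmult_1_r (2 / kappa * M * (1 + theta) * Cmod (xi ^ (n + 1)))) at 1.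
  apply Rmult_le_compat_l.
  + pose proof (Cmod_ge_0 v); repeat apply Rmult_le_pos; try lra.
    left; now apply Rinv_0_lt_compat.
  + apply Rle_div_r; lra.
- rewrite Cmod_div by exact Hd0.
  assert (Hnum : (Cmod ((v - 1) * fz + (fz - power_series f al)) <=
                  theta * M + / (1 - q) ^ 2 * s)%R).
  { eapply Rle_trans; [apply Cmod_triangle|]; rewrite Cmod_mult.
    apply Rplus_le_compat; [|exact Hfd].
    apply Rmult_le_compat; auto using Cmod_ge_0. }
  apply Rmult_le_compat; auto using Cmod_ge_0.
  + left; now apply Rinv_0_lt_compat.
  + apply Rinv_le_contravar; lra.
Qed.

(** * Limits of the error terms *)

(** These are the terms of the derived geometric series, which has radius of convergence 1, and
    terms of a convergent series tend to 0. *)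
Lemma is_lim_seq_INR_geom (q : R) :
  (0 <= q < 1)%R -> is_lim_seq (fun n => INR (n + 1) * q ^ n)%R 0.
Proof.
intros HR.
assert (Hrad : CV_radius (PS_derive (fun _ => 1%R)) = Finite 1).
{ rewrite CV_radius_derive; replace (Finite 1) with (Finite (/ 1)) by now rewrite Rinv_1.
  apply CV_radius_finite_DAlembert; [intros _; apply R1_neq_R0 | lra|].
  apply is_lim_seq_ext with (fun _ => 1%R); [|apply is_lim_seq_const].
  intros n; rewrite Rdiv_1_r, Rabs_R1; reflexivity. }
assert (H : ex_series (fun n => Rabs (PS_derive (fun _ => 1%R) n * q ^ n))).
{ apply CV_disk_inside; rewrite Hrad; simpl; rewrite Rabs_pos_eq; lra. }
apply ex_series_lim_0 in H.
eapply is_lim_seq_ext; [|exact H].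
intros n; unfold PS_derive; cbv beta.
rewrite Rmult_1_r, Nat.add_1_r, Rabs_pos_eq; [reflexivity|].
apply Rmult_le_pos; [apply pos_INR | apply pow_le, HR].
Qed.

Lemma is_lim_seq_scal_0 (c : R) (u : nat -> R) :
  is_lim_seq u 0 -> is_lim_seq (fun n => c * u n)%R 0.
Proof.
intros H; replace (Finite 0) with (Rbar_mult c 0) by (simpl; f_equal; ring).
now apply is_lim_seq_scal_l.
Qed.

Lemma is_lim_seq_plus_0 (u v : nat -> R) :
  is_lim_seq u 0 -> is_lim_seq v 0 -> is_lim_seq (fun n => u n + v n)%R 0.
Proof.
intros Hu Hv; replace (Finite 0) with (Finite (0 + 0)) by (f_equal; ring).
now apply is_lim_seq_plus'.
Qed.

Lemma root_radius_lim (q kappa : R) :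
  (0 <= q < 1)%R -> is_lim_seq (root_radius q kappa) 0.
Proof.
intros Hq; apply is_lim_seq_scal_0, is_lim_seq_geom; rewrite Rabs_pos_eq; lra.
Qed.

Lemma perturbation_lip_lim (q : R) :
  (0 <= q < 1)%R -> is_lim_seq (perturbation_lip q) 0.
Proof.
intros Hq; apply is_lim_seq_plus_0.
- eapply is_lim_seq_ext; [intros n; apply Rmult_comm|].
  now apply is_lim_seq_scal_0, is_lim_seq_INR_geom.
- apply is_lim_seq_ext with (fun n => q * (2 / (1 - q) ^ 2) * q ^ n)%R.
  + intros n; rewrite pow_add; ring.
  + apply is_lim_seq_scal_0, is_lim_seq_geom; rewrite Rabs_pos_eq; lra.
Qed.

Lemma slope_error_lim (q kappa : R) :
  (0 <= q < 1)%R -> is_lim_seq (slope_error q kappa) 0.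
Proof.
intros Hq; apply is_lim_seq_plus_0; [|now apply perturbation_lip_lim].
now apply is_lim_seq_scal_0, root_radius_lim.
Qed.

Lemma ratio_error_lim (q kappa x : R) :
  (0 <= q < 1)%R -> is_lim_seq (ratio_error q kappa x) 0.
Proof.
intros Hq.
replace (Finite 0) with (Finite (exp 0 - 1)) by (rewrite exp_0; f_equal; ring).
apply is_lim_seq_minus'; [|apply is_lim_seq_const].
apply (is_lim_seq_continuous exp); [apply derivable_continuous_pt, derivable_pt_exp|].
apply is_lim_seq_ext with
  (fun n => 4 * (4 / (kappa * (1 - q))) / x * (INR (n + 1) * q ^ n))%R.
- intros n; unfold root_radius, Rdiv; ring.
- now apply is_lim_seq_scal_0, is_lim_seq_INR_geom.
Qed.

Lemma rescaling_error_lim (q kappa x : R) :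
  (0 <= q < 1)%R -> is_lim_seq (rescaling_error q kappa x) 0.
Proof.
intros Hq; apply is_lim_seq_plus_0.
- apply is_lim_seq_ext with (fun n =>
    (2 / (1 - q) / kappa ^ 2) * slope_error q kappa n * (1 + ratio_error q kappa x n))%R.
  { intros n; ring. }
  replace (Finite 0) with (Finite (0 * (1 + 0))) by (f_equal; ring).
  apply is_lim_seq_mult'.
  + now apply is_lim_seq_scal_0, slope_error_lim.
  + apply is_lim_seq_plus'; [apply is_lim_seq_const | now apply ratio_error_lim].
- apply is_lim_seq_ext with (fun n =>
    / kappa * (/ (1 - q) * ratio_error q kappa x n + / (1 - q) ^ 2 * root_radius q kappa n))%R.
  { intros n; unfold Rdiv; ring. }
  apply is_lim_seq_scal_0, is_lim_seq_plus_0; apply is_lim_seq_scal_0.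
  + now apply ratio_error_lim.
  + now apply root_radius_lim.
Qed.

Lemma eventually_le_of_lim_0 (u : nat -> R) (eps : R) :
  is_lim_seq u 0 -> (0 < eps)%R -> eventually (fun n => u n <= eps)%R.
Proof.
intros Hu He; apply is_lim_seq_spec in Hu.
destruct (Hu (mkposreal eps He)) as [N HN]; exists N; intros n Hn.
specialize (HN n Hn); simpl in HN; rewrite Rminus_0_r in HN.
apply Rabs_lt_between in HN; lra.
Qed.

(** * The local limit of the rescaled root sets *)

Theorem theorem1 :
  forall (K : C -> Prop) (kappa : R),
    is_compact K -> subset_of K unit_disk -> (0 < kappa)%R ->
    exists r0 : R, (0 < r0)%R /\
      forall (a : nat -> C) (alpha : C),
        littlewood a -> good kappa K a ->
        K alpha -> power_series a alpha = 0 ->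
        exists alpha_ : nat -> C,
          eventually (fun n => unit_disk (alpha_ n) /\ prefix a n (alpha_ n) = 0) /\
          filterlim alpha_ eventually (locally alpha) /\
          (locally alpha K -> eventually (fun n => K (alpha_ n))) /\
          let R_loc := fun n z => extension_roots a n z /\ disk alpha r0 z in
          let D_alpha :=
            image (fun w => / C_derive (power_series a) alpha * w) (dragon alpha) in
          let d := fun n =>
            hausdorff_dist (image (T n (alpha_ n)) (R_loc n)) D_alpha in
          eventually (fun n => is_finite (d n)) /\
          is_lim_seq (fun n => real (d n)) 0.
Proof.
intros K kappa HK HKd Hk.
destruct (compact_in_smaller_disk K HK HKd) as [rho [Hrho HKrho]].
set (q := ((1 + rho) / 2)%R).
assert (Hq : (0 <= q < 1)%R) by (unfold q; lra).
assert (HD : (0 < 2 / (1 - q) ^ 3)%R) by (apply Rdiv_lt_0_compat; [lra | apply pow_lt; lra]).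
(* The first entry keeps the disk about any point of [K] inside [|z| <= q]. The second bounds the
   second order remainder by [kappa / 4]. Both are fixed before the series and its root. *)
set (r0 := Rmin ((1 - rho) / 2) (kappa / 4 / (2 / (1 - q) ^ 3))).
assert (Hr0 : (0 < r0)%R) by (apply Rmin_pos; [lra | apply Rdiv_lt_0_compat; lra]).
exists r0; split; [exact Hr0|].
intros a alpha HaL Hgood HKa Hroot.
pose proof (littlewood_bounded a HaL) as Ha.
assert (Hal : unit_disk alpha) by now apply HKd.
assert (Hsum : (Cmod alpha + r0 <= q)%R).
{ pose proof (HKrho _ HKa); pose proof (Rmin_l ((1 - rho) / 2) (kappa / 4 / (2 / (1 - q) ^ 3))).
  fold r0 in H0; unfold q; lra. }
assert (Hr0D : (2 / (1 - q) ^ 3 * r0 <= kappa / 4)%R).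
{ rewrite Rmult_comm; apply Rle_div_r; [exact HD | apply Rmin_r]. }
pose proof (Hgood alpha HKa Hroot) as Hd; rewrite C_derive_power_series in * by assumption.
set (d := power_series_deriv a alpha) in *.
(* At 0 the series takes the value [a 0], which is 1 or -1. A nonzero [alpha] keeps the denominators
   [alpha_n^(n+1)] away from 0 for large [n]. *)
assert (Hal0 : alpha <> 0).
{ intros E; rewrite E in Hroot, Hal; rewrite power_series_shift in Hroot by assumption.
  rewrite Cmult_0_l, Cplus_0_r in Hroot.
  pose proof Cmod_0 as H0; rewrite <- Hroot in H0.
  destruct (HaL O) as [E1 | E1]; rewrite E1, ?Cmod_m1, ?Cmod_1 in H0; lra. }
assert (Hal0' : (0 < Cmod alpha)%R) by now apply Cmod_gt_0.
assert (Hzero : bounded_coef (fun _ => RtoC 0)) by (intros k; rewrite Cmod_0; lra).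
assert (Hclose : forall f n z, bounded_coef f -> (Cmod (z - alpha) < r0)%R ->
  extension a n f z = 0 -> (Cmod (z - alpha) <= root_radius q kappa n)%R).
{ intros f n z Hf Hz Hfz; apply (extension_root_close q kappa r0 a f); auto; lra. }
(* The threshold is uniform in [f]. This gives both [alpha_n], from the zero series, and a root for
   every Littlewood [f]. *)
assert (Hex : eventually (fun n => forall f, bounded_coef f ->
  exists z, (Cmod (z - alpha) < r0)%R /\ extension a n f z = 0)).
{ destruct (eventually_le_of_lim_0 _ (kappa / 4) (perturbation_lip_lim q Hq)) as [N1 H1]; [lra|].
  destruct (eventually_le_of_lim_0 _ (r0 / 2) (root_radius_lim q kappa Hq)) as [N2 H2]; [lra|].
  exists (Nat.max N1 N2); intros n Hn f Hf.
  apply (extension_root_exists q kappa); auto; [apply H1 | apply H2]; lia. }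
destruct Hex as [N HN].
destruct (choice (fun n z => (N <= n)%nat ->
  (Cmod (z - alpha) < r0)%R /\ prefix a n z = 0)) as [alpha_ Halpha_].
{ intros n; destruct (Nat.le_gt_cases N n) as [Hn | Hn]; [|exists alpha; lia].
  destruct (HN n Hn _ Hzero) as [z [Hz Hz0]].
  exists z; rewrite extension_0 in Hz0; auto. }
assert (Hnear : forall n, (N <= n)%nat -> (Cmod (alpha_ n - alpha) <= root_radius q kappa n)%R).
{ intros n Hn; destruct (Halpha_ n Hn) as [H1 H2].
  apply (Hclose (fun _ => 0)); auto; now rewrite extension_0. }
assert (Hdisk : forall z, (Cmod (z - alpha) < r0)%R -> (Cmod z <= q)%R).
{ intros z Hz; pose proof (Cmod_le_sub z alpha); lra. }
assert (Hconv : filterlim alpha_ eventually (locally alpha)).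
{ intros P HP; apply (proj1 (locally_Cmod alpha P)) in HP; destruct HP as [eps HP].
  destruct (eventually_le_of_lim_0 _ (eps / 2) (root_radius_lim q kappa Hq)) as [N1 H1].
  { pose proof (cond_pos eps); lra. }
  exists (Nat.max N N1); intros n Hn; apply HP.
  pose proof (cond_pos eps); pose proof (Hnear n ltac:(lia)); pose proof (H1 n ltac:(lia)); lra. }
(* Membership in [K] follows from convergence once [K] is a neighbourhood of [alpha]. For [K]
   reduced to [alpha] it fails infinitely often, since consecutive prefixes differ there by a
   nonzero multiple of a power of [alpha]. *)
exists alpha_; split; [|split; [exact Hconv | split; [intros HKl; exact (Hconv K HKl)|]]].
{ exists N; intros n Hn; destruct (Halpha_ n Hn) as [H1 H2]; split; [|exact H2].
  pose proof (Hdisk _ H1); unfold unit_disk; lra. }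
intros R_loc D_alpha dist.
assert (Hdist : eventually (fun n => is_finite (dist n) /\
  (0 <= real (dist n) <= rescaling_error q kappa (Cmod alpha) n)%R)).
{ destruct (eventually_le_of_lim_0 _ (kappa / 2) (slope_error_lim q kappa Hq)) as [N1 H1]; [lra|].
  destruct (eventually_le_of_lim_0 _ (Cmod alpha / 2) (root_radius_lim q kappa Hq)) as [N2 H2];
    [lra|].
  exists (Nat.max N (Nat.max N1 N2)); intros n Hn.
  assert (HnN : (N <= n)%nat) by lia.
  destruct (Halpha_ n HnN) as [Hxi Hxi0].
  assert (Hresc : forall f z, bounded_coef f -> (Cmod (z - alpha) < r0)%R ->
    extension a n f z = 0 ->
    (Cmod (T n (alpha_ n) z - / d * - power_series f alpha)
       <= rescaling_error q kappa (Cmod alpha) n)%R).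
  { intros f z Hf Hz Hfz.
    apply (rescaled_root_close q kappa a f n alpha (alpha_ n) z); eauto; try lra.
    - apply H1; lia.
    - apply H2; lia. }
  assert (HR_loc : forall f, littlewood f -> exists z, R_loc n z /\ extension a n f z = 0).
  { intros f Hf; destruct (HN n HnN f (littlewood_bounded f Hf)) as [z [Hz Hfz]].
    exists z; repeat split; auto; [|now exists f].
    pose proof (Hdisk _ Hz); unfold unit_disk; lra. }
  assert (Hopp : forall f, littlewood f -> littlewood (fun k => - f k)).
  { intros f Hf k; destruct (Hf k) as [-> | ->]; [now right | left; ring]. }
  assert (Hval : forall f, littlewood f -> dragon alpha (power_series f alpha)).
  { intros f Hf; apply dragon_values; [exact Hal | now exists f]. }
  assert (Hone : littlewood (fun _ => RtoC 1)) by (intros k; now left).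
  apply hausdorff_dist_le.
  - destruct (HR_loc _ Hone) as [z [Hz _]]; exists (T n (alpha_ n) z), z; auto.
  - exists (/ d * power_series (fun _ => 1) alpha), (power_series (fun _ => 1) alpha); auto.
  - intros t [z [[[_ [f [Hf Hfz]]] Hz] <-]].
    exists (/ d * - power_series f alpha); split; [|now apply Hresc; auto using littlewood_bounded].
    exists (- power_series f alpha); split; [|reflexivity].
    rewrite <- power_series_opp; now apply Hval, Hopp.
  (* The point with series [g] is approached by the root for the extension by [- g], the sign coming
     from [P_n(z) = - z^(n+1) f(z)]. *)
  - intros t [v [Hv <-]].
    apply dragon_values in Hv; [|exact Hal]; destruct Hv as [g [Hg <-]].
    destruct (HR_loc _ (Hopp g Hg)) as [z [Hz Hfz]].
    exists (T n (alpha_ n) z); split; [now exists z|].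
    rewrite Cmod_sub_sym.
    pose proof (Hresc _ z (littlewood_bounded _ (Hopp g Hg)) (proj2 Hz) Hfz) as H.
    rewrite power_series_opp in H.
    replace (- - power_series g alpha) with (power_series g alpha) in H by ring; exact H. }
(* As [real] sends infinite values to 0, finiteness is proved separately, and the limit then follows
   by squeezing. *)
split.
- revert Hdist; apply filter_imp; tauto.
- apply is_lim_seq_le_le_loc with (fun _ => 0%R) (rescaling_error q kappa (Cmod alpha)).
  + revert Hdist; apply filter_imp; tauto.
  + apply is_lim_seq_const.
  + now apply rescaling_error_lim.
Qed.
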